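(* Assume the setting and Assumption 2 described in the context, and let $\boldsymbol\theta^*$ and $\widehat{\boldsymbol\theta}_{N_1,N_2,N_3}$ be optimal solutions of $\min_{\boldsymbol\theta\in\Theta}F(\boldsymbol\theta)$ and $\min_{\boldsymbol\theta\in\Theta}\widehat F_{N_1,N_2,N_3}(\boldsymbol\theta)$ respectively. Then, with $C>0$ an absolute constant: (a) For any $\kappa>0$ there exists $\delta_1>0$ such that for any $\delta\in(0,\delta_1)$, $\Pr\big(F(\widehat{\boldsymbol\theta}_{N_1,N_2,N_3})-F(\boldsymbol\theta^* )>\delta\big)\le C\Big(\frac{8L_1L_2L_3D_\Theta}{\delta}\Big)^{d_\theta}\Big(N_1N_2\,n\,\exp\Big(-\frac{N_3\delta^2}{144(2+\kappa)\lambda^2\epsilon^2L_1^2L_2^2\sigma_3^2}\Big)+N_1\exp\Big(-\frac{N_2\delta^2}{144(2+\kappa)\lambda^2\epsilon^2L_1^2\sigma_2^2}\Big)+\exp\Big(-\frac{N_1\delta^2}{144(2+\kappa)\lambda^2\epsilon^2\sigma_1^2}\Big)\Big)$. (b) For $\delta\in(0,\delta_1)$ as in (a) and $\alpha\in(0,1)$, with probability at least $1-\alpha$ the solution $\widehat{\boldsymbol\theta}_{N_1,N_2,N_3}$ satisfies $F(\widehat{\boldsymbol\theta}_{N_1,N_2,N_3})-F(\boldsymbol\theta^* )\le\delta$ provided $N_1>\frac{C\sigma_1^2}{\delta^2}\big[d_\theta\log(\tfrac{8L_1L_2L_3D_\Theta}{\delta})+\log(\tfrac1\alpha)\big]$,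 $N_2>\frac{CL_1^2\sigma_2^2}{\delta^2}\big[d_\theta\log(\tfrac{8L_1L_2L_3D_\Theta}{\delta})+\log(\tfrac1\alpha)+\log N_1\big]$, $N_3>\frac{CL_1^2L_2^2\sigma_3^2}{\delta^2}\big[d_\theta\log(\tfrac{8L_1L_2L_3D_\Theta}{\delta})+\log(\tfrac1\alpha)+\log(N_1N_2n)\big]$. Consequently, up to logarithmic factors, a total sample size $N_1+N_2+N_3=\mathcal O(d_\theta/\delta^2)$ suffices for a $\delta$-optimal solution with probability at least $1-\alpha$.
   Context: Let $\widehat{\mathbb P}$ be an empirical (finitely supported) distribution of covariate/outcome pairs $(\widehat{\boldsymbol x},\widehat{\boldsymbol y})\in\mathbb R^{d_x}\times\mathbb R^{d_y}$ with covariate marginal $\widehat{\mathbb P}_{\widehat{\boldsymbol X}}$. For each $\widehat{\boldsymbol x}$ in the support, let $\widehat{\boldsymbol y}_1,\dots,\widehat{\boldsymbol y}_{n_{\widehat{\boldsymbol x}}}$ be the observed outcomes with covariate $\widehat{\boldsymbol x}$, with empirical conditional probabilities $\widehat p(\widehat{\boldsymbol y}_i\mid\widehat{\boldsymbol x})$ (summing to 1); let $n=\max_{\widehat{\boldsymbol x}}n_{\widehat{\boldsymbol x}}$. Fix $p\in[1,\infty)$, $\lambda>0$, $\epsilon>0$, reference measures $\nu_{\mathcal X}$ on $\mathbb R^{d_x}$, $\nu_{\mathcal Y}$ on $\mathbb R^{d_y}$, and kernel distributions $\mathrm dQ_\epsilon(\boldsymbol\xi_1)\propto e^{-\|\boldsymbol\xi_1\|^p/\epsilon}\mathrm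 d\nu_{\mathcal X}(\boldsymbol\xi_1)$, $\mathrm dW_\epsilon(\boldsymbol\xi_2)\propto e^{-\|\boldsymbol\xi_2\|^p/\epsilon}\mathrm d\nu_{\mathcal Y}(\boldsymbol\xi_2)$ (normalized). Let $\Psi:\mathcal Z\times\mathcal Y\to\mathbb R$ be a loss and $f_{\boldsymbol\theta}$, $\boldsymbol\theta\in\Theta\subseteq\mathbb R^{d_\theta}$, a parametric decision rule. Define $t_1(z)=\log z$; $t_2(\boldsymbol v;\widehat{\boldsymbol x},\boldsymbol\xi_1)=\exp\big(\sum_{i=1}^{n_{\widehat{\boldsymbol x}}}\widehat p(\widehat{\boldsymbol y}_i\mid\widehat{\boldsymbol x})\log v_i\big)$; and $t_3(\boldsymbol\theta;\widehat{\boldsymbol x},\boldsymbol\xi_1,\boldsymbol\xi_2)\in\mathbb R^{n_{\widehat{\boldsymbol x}}}$ with $[t_3]_i=\exp\big(\Psi(f_{\boldsymbol\theta}(\widehat{\boldsymbol x}+\boldsymbol\xi_1),\widehat{\boldsymbol y}_i+\boldsymbol\xi_2)/(\lambda\epsilon)\big)$. Let $\phi^{(2)}(\boldsymbol\theta;\widehat{\boldsymbol x},\boldsymbol\xi_1)=\mathbb E_{\boldsymbol\xi_2\sim W_\epsilon}[t_3(\boldsymbol\theta;\widehat{\boldsymbol x},\boldsymbol\xi_1,\boldsymbol\xi_2)]$, $\phi^{(1)}(\boldsymbol\theta;\widehat{\boldsymbol x})=\mathbb E_{\boldsymbol\xi_1\sim Q_\epsilon}[t_2(\phi^{(2)}(\boldsymbol\theta;\widehat{\boldsymbol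 x},\boldsymbol\xi_1);\widehat{\boldsymbol x},\boldsymbol\xi_1)]$, and $F(\boldsymbol\theta)=\lambda\epsilon\,\mathbb E_{\widehat{\boldsymbol x}\sim\widehat{\mathbb P}_{\widehat{\boldsymbol X}}}[t_1(\phi^{(1)}(\boldsymbol\theta;\widehat{\boldsymbol x}))]$. SAA: draw i.i.d. $(\widehat{\boldsymbol x}^i,\widehat{\boldsymbol y}^i)\sim\widehat{\mathbb P}$, $i\le N_1$; i.i.d. $\boldsymbol\xi_1^j\sim Q_\epsilon$, $j\le N_2$; i.i.d. $\boldsymbol\xi_2^k\sim W_\epsilon$, $k\le N_3$, all independent, and set $\widehat F_{N_1,N_2,N_3}(\boldsymbol\theta)=\frac{\lambda\epsilon}{N_1}\sum_{i=1}^{N_1}t_1\Big(\frac1{N_2}\sum_{j=1}^{N_2}t_2\Big(\frac1{N_3}\sum_{k=1}^{N_3}t_3(\boldsymbol\theta;\widehat{\boldsymbol x}^i,\boldsymbol\xi_1^j,\boldsymbol\xi_2^k);\widehat{\boldsymbol x}^i,\boldsymbol\xi_1^j\Big)\Big)$. Assumption 2: (i) $\Theta$ has finite diameter $D_\Theta>0$; (ii) for all $\boldsymbol x,\boldsymbol y$, $\boldsymbol\theta\mapsto\Psi(f_{\boldsymbol\theta}(\boldsymbol x),\boldsymbol y)$ is $L_{\boldsymbol\theta}$-Lipschitz; (iii) $0\le\Psi(\boldsymbol z,\boldsymbol y)\le B$ for all $\boldsymbol z,\boldsymbol y$. Constants: $L_1=1$, $L_2=\exp(B/(\lambda\epsilon))$,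 $L_3=\frac1{\lambda\epsilon}\exp(B/(\lambda\epsilon))$; $\sigma_1^2=\sup_{\boldsymbol\theta}\mathbb V_{\widehat{\boldsymbol x}}(t_1(\phi^{(1)}(\boldsymbol\theta;\widehat{\boldsymbol x})))$, $\sigma_2^2=\sup_{\boldsymbol\theta,\widehat{\boldsymbol x}}\mathbb V_{\boldsymbol\xi_1}(t_2(\phi^{(2)}(\boldsymbol\theta;\widehat{\boldsymbol x},\boldsymbol\xi_1);\widehat{\boldsymbol x},\boldsymbol\xi_1))$, $\sigma_3^2=\sup_{\boldsymbol\theta,\widehat{\boldsymbol x},\boldsymbol\xi_1}\mathbb V_{\boldsymbol\xi_2}(t_3(\boldsymbol\theta;\widehat{\boldsymbol x},\boldsymbol\xi_1,\boldsymbol\xi_2))$, where for a random vector $\mathbb V(\boldsymbol Z)=\mathbb E\|\boldsymbol Z-\mathbb E\boldsymbol Z\|^2$. *)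

(* Defs.v *)
From HB Require Import structures.
From mathcomp Require Import all_boot all_order all_algebra.
From mathcomp Require Import all_classical all_reals all_analysis.
Set Implicit Arguments. Unset Strict Implicit. Unset Printing Implicit Defensive.
Import Order.TTheory GRing.Theory Num.Theory.
Import numFieldNormedType.Exports.
Local Open Scope classical_set_scope.
Local Open Scope ring_scope.

Section Defs.
Variable R : realType.

(* Euclidean norm on R^d (row vectors); the library norm on 'rV is the sup norm *)
Definition enorm (d : nat) (v : 'rV[R]_d) : R :=
  Num.sqrt (\sum_(i < d) (v ord0 i) ^+ 2).

Definition diam (d : nat) (Th : set 'rV[R]_d) : R :=
  sup [set enorm (a - b) | a in Th & b in Th].

Definition Borel (d : nat) := g_sigma_algebraType (@open 'rV[R]_d).

Definition Ex (d : nat) (mu : {measure set (Borel d) -> \bar R})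
  (g : 'rV[R]_d -> R) : R := fine (\int[mu]_x (g x)%:E).
Definition Var (d : nat) (mu : {measure set (Borel d) -> \bar R})
  (g : 'rV[R]_d -> R) : R := Ex mu (fun x => (g x - Ex mu g) ^+ 2).

(* The empirical distribution hat P is given by finitely many atoms s : S with
   (distinct) locations z s = (hat x, hat y) and positive weights pw s summing to 1.
   The outcomes observed with covariate (z s).1 are the atoms of the class cls z s. *)
Section Problem.
Variables (dx dy dth : nat) (S : finType)
  (z : S -> 'rV[R]_dx * 'rV[R]_dy) (pw : S -> R).

Definition cls (s : S) : pred S := [pred s' | (z s').1 == (z s).1].
Definition pcond (s s' : S) : R := pw s' / \sum_(s'' in cls s) pw s''.
Definition nmax : nat := \max_(s : S) #|cls s|.

Variables (Z : Type) (Psi : Z -> 'rV[R]_dy -> R) (f : 'rV[R]_dth -> 'rV[R]_dx -> Z)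
  (lam eps : R).

Definition t3 (th : 'rV[R]_dth) (x : 'rV[R]_dx) (xi1 : 'rV[R]_dx)
  (xi2 : 'rV[R]_dy) (s' : S) : R :=
  expR (Psi (f th (x + xi1)) ((z s').2 + xi2) / (lam * eps)).
Definition t2 (s : S) (v : S -> R) : R :=
  expR (\sum_(s' in cls s) pcond s s' * ln (v s')).
Definition t1 (u : R) : R := ln u.

Variables (Q : {measure set (Borel dx) -> \bar R})
          (W : {measure set (Borel dy) -> \bar R}).

Definition phi2 (th : 'rV[R]_dth) (s : S) (xi1 : 'rV[R]_dx) : S -> R :=
  fun s' => Ex W (fun xi2 => t3 th (z s).1 xi1 xi2 s').
Definition phi1 (th : 'rV[R]_dth) (s : S) : R :=
  Ex Q (fun xi1 => t2 s (phi2 th s xi1)).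
Definition Fobj (th : 'rV[R]_dth) : R :=
  lam * eps * \sum_(s : S) pw s * t1 (phi1 th s).

Definition Fhat (N1 N2 N3 : nat) (sx : 'I_N1 -> S) (x1 : 'I_N2 -> 'rV[R]_dx)
  (x2 : 'I_N3 -> 'rV[R]_dy) (th : 'rV[R]_dth) : R :=
  lam * eps / N1%:R * \sum_(i < N1) t1 (N2%:R^-1 * \sum_(j < N2)
     t2 (sx i) (fun s' => N3%:R^-1 * \sum_(k < N3) t3 th (z (sx i)).1 (x1 j) (x2 k) s')).

Variable Th : set 'rV[R]_dth.

Definition sigma1sq : R :=
  sup [set (\sum_(s : S) pw s * (t1 (phi1 th s) - \sum_(s0 : S) pw s0 * t1 (phi1 th s0)) ^+ 2)
      | th in Th].
Definition sigma2sq : R :=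
  sup [set Var Q (fun xi1 => t2 s (phi2 th s xi1)) | th in Th & s in [set: S]].
(* variance of a random vector = E||Z - EZ||^2 = sum of coordinate variances *)
Definition sigma3sq : R :=
  sup [set (\sum_(s' in cls sx1.1) Var W (fun xi2 => t3 th (z sx1.1).1 sx1.2 xi2 s'))
      | th in Th & sx1 in [set: S * 'rV[R]_dx] ].
End Problem.
End Defs.

Arguments enorm {R d}.
Arguments diam {R d}.
Arguments Borel {R}.

Section Model.
Variable R : realType.
Local Open Scope ereal_scope.

Definition kernel_law (d : nat) (nu : {measure set (Borel d) -> \bar R}) (p eps : R)
  (Q : probability (Borel d) R) : Prop :=
  exists Zn : R, (0 < Zn)%R /\ forall A : set (Borel d), measurable A ->
    Q A = (Zn^-1)%:E * \int[nu]_(x in A) (expR (- (enorm x `^ p) / eps))%:E.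

Definition Psi_measurable (dx dy dth : nat) (Z : Type) (Psi : Z -> 'rV[R]_dy -> R)
  (f : 'rV[R]_dth -> 'rV[R]_dx -> Z) : Prop :=
  forall (th : 'rV[R]_dth) (x : 'rV[R]_dx) (y : 'rV[R]_dy),
    measurable_fun [set: (Borel dx * Borel dy)%type]
      (fun q : (Borel dx * Borel dy)%type =>
         Psi (f th (x + (q.1 : 'rV[R]_dx))%R) (y + (q.2 : 'rV[R]_dy))%R).

(* The samples: sx i (index of the atom (hat x^i, hat y^i) drawn from hat P),
   x1 j ~ Q, x2 k ~ W, all i.i.d. and mutually independent, on (Omega, P). *)
Definition iid_samples (dx dy : nat) (S : finType) (pw : S -> R)
  (Q : probability (Borel dx) R) (W : probability (Borel dy) R)
  (N1 N2 N3 : nat) (d0 : measure_display) (Om : measurableType d0)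
  (P : probability Om R) (sx : 'I_N1 -> Om -> S)
  (x1 : 'I_N2 -> Om -> 'rV[R]_dx) (x2 : 'I_N3 -> Om -> 'rV[R]_dy) : Prop :=
  [/\ (forall i s, measurable [set om | sx i om = s]),
      (forall j (B : set (Borel dx)), measurable B -> measurable [set om | B (x1 j om)]),
      (forall k (C : set (Borel dy)), measurable C -> measurable [set om | C (x2 k om)]) &
      forall (A : 'I_N1 -> {set S}) (B : 'I_N2 -> set (Borel dx))
             (C : 'I_N3 -> set (Borel dy)),
        (forall j, measurable (B j)) -> (forall k, measurable (C k)) ->
        P ((\bigcap_(i : 'I_N1) [set om | sx i om \in A i]) `&`
           (\bigcap_(j : 'I_N2) [set om | B j (x1 j om)]) `&`
           (\bigcap_(k : 'I_N3) [set om | C k (x2 k om)])) =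
        ((\prod_(i < N1) \sum_(s in A i) pw s) *
         (\prod_(j < N2) fine (Q (B j))) * (\prod_(k < N3) fine (W (C k))))%:E].
End Model.

(* Main.v *)
Require Import Defs.
From HB Require Import structures.
From mathcomp Require Import all_boot all_order all_algebra.
From mathcomp Require Import all_classical all_reals all_analysis.
From mathcomp Require unstable.
From mathcomp Require Import measurable_realfun ring lra.
Import Order.TTheory GRing.Theory Num.Theory.
Import numFieldNormedType.Exports.
Local Open Scope classical_set_scope.
Local Open Scope ring_scope.
Set Implicit Arguments.
Unset Strict Implicit.

(** Since [delta1] may depend on all the problem data (but not on the sample sizes
    nor on [alpha]), the constants in front of the exponentials and inside them are
    not those of a plain Hoeffding bound on a net.  The gap [F thhat - F thstar]
    is controlled by increments of [Fhat - F]: points whose value is within a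
    fixed [g] of the minimum have neighbours, at any prescribed distance [rho],
    whose value is arbitrarily close to the minimum, and comparing [thhat] with
    such a neighbour only involves second differences, of size
    [O(rho * tau + r)], where [tau] bounds the first-order deviations and [r] the
    deviations of increments, whose summands are [O(rho)].  Taking
    [tau = O(sqrt K * delta)], [r = O(delta)] and [rho = O(1 / sqrt K)] gives the
    exponential rate [K * N * delta^2] for every [K], on a net of polynomial
    cardinality in [1 / delta].  A large [K] then absorbs the cardinality of the
    net, the Lipschitz constants and the factor [lam^2 * eps^2].  When some sigma
    vanishes, the corresponding layer has no fluctuation at all. *)

(** * Chernoff bounds for conditionally independent samples *)

(** The prefactors disappear by a dichotomy. If the claimed bound is at least 1, there is nothing to
    prove. Otherwise each exponential in it lies below [(delta / c) ^+ d], where [(c / delta) ^+ d]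
    is the covering factor, and a rate four times larger yields three spare powers of that number.
    Comparing two net points costs the square of the net, of order [delta^-1 ^+ (2 * d)], so a
    factor [delta ^+ d] remains and, for small [delta], beats every constant. The layers are not
    independent of each other in the naive sense: the same [x2 k] serve every [x1 j]. Each inner
    average is therefore treated with a single [x1 j] frozen, and the union over [j] costs [N2]. The
    outer samples are grouped by atom, so their union ranges over [S] and costs no [N1].
    Independence is given as a product formula on rectangles; the exponential bounds are accordingly
    run on events, with summands rounded to finitely many values. *)

Lemma le_measure_big_setU {d} {T : measurableType d} {R : realType}
    (mu : {measure set T -> \bar R}) {I : Type} (s : seq I) (A : I -> set T) :
  (forall i, measurable (A i)) ->
  (mu (\big[setU/set0]_(i <- s) A i) <= \sum_(i <- s) mu (A i))%E.
Proof.
move=> mA; elim: s => [|i s IHs]; first by rewrite !big_nil measure0.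
rewrite !big_cons; apply: le_trans (measureU2 mu _ _) _ => //.
  exact: bigsetU_measurable.
exact: leeD2l.
Qed.

Lemma le_measure_fin_cover {d} {T : measurableType d} {R : realType}
    (mu : {measure set T -> \bar R}) {I : finType} (A : set T) (F : I -> set T) :
  measurable A -> (forall i, measurable (F i)) ->
  (forall x, A x -> exists i, F i x) -> (mu A <= \sum_(i : I) mu (F i))%E.
Proof.
move=> mA mF AF; apply: le_trans (le_measure_big_setU mu (index_enum I) mF).
rewrite le_measure ?inE//; first exact: bigsetU_measurable.
by move=> x /AF[i Fix]; rewrite -bigcup_seq; exists i => //=; rewrite mem_index_enum.
Qed.

Lemma measurable_fun_finite_valued {d} {T : measurableType d} {R : realType}
    {M : finType} (V : T -> M) (f : M -> R) :
  (forall a, measurable [set x | V x = a]) -> measurable_fun setT (f \o V).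
Proof.
move=> mV.
have -> : f \o V = fun x => \sum_(a : M) f a * \1_[set x | V x = a] x.
  apply/funext => x /=; rewrite (bigD1 (V x))//= indicE mem_set// mulr1 big1 ?addr0//.
  move=> a aV; rewrite indicE memNset ?mulr0//= => /esym/eqP.
  by apply/negP.
apply: measurable_sum => a; apply: measurable_funM => //.
Qed.

Section chernoff.
Context {d} {Om : measurableType d} {R : realType} (P : probability Om R).
Variables (N : nat) (M : finType) (V : 'I_N -> Om -> M) (v : M -> R) (l c : R).
Variable Past : nat -> set Om -> Prop.
Hypothesis l0 : 0 <= l.
Hypothesis mV : forall i a, measurable [set om | V i om = a].
Hypothesis mPast : forall m G, Past m G -> measurable G.
Hypothesis PastS : forall (m : 'I_N) G a, Past m G ->
  Past m.+1 (G `&` [set om | V m om = a]).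
Hypothesis Past_mgf : forall (m : 'I_N) G, Past m G ->
  (\sum_(a : M) (expR (l * v a))%:E * P (G `&` [set om | V m om = a])
   <= (expR c)%:E * P G)%E.

Let tail (m : nat) (t : R) := [set om | t <= \sum_(i < N | (m <= i)%N) v (V i om)].

Let mtail (m : nat) (t : R) : measurable (tail m t).
Proof.
rewrite /tail.
have mS : measurable_fun setT (fun om => \sum_(i < N | (m <= i)%N) v (V i om)).
  under eq_fun do rewrite big_mkcond.
  apply: measurable_sum => i; case: (m <= i)%N => //=.
  exact: (measurable_fun_finite_valued v (mV i)).
rewrite (_ : [set om | _] = (fun om => \sum_(i < N | (m <= i)%N) v (V i om)) @^-1` `[t, +oo[).
  by rewrite -[X in measurable X]setTI; apply: mS.
by apply/seteqP; split => om /=; rewrite in_itv/= andbT.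
Qed.

(** [Past m] stands for events decided before sample [m]. Splitting on the value [a] of that sample
    stays in the past of [m.+1] and lowers the threshold to [t - v a]; the induction hypothesis then
    carries the factor [expR (l * v a)], whose sum over [a] is what [Past_mgf] bounds. No
    expectation of a product is formed. *)
Lemma chernoff_tail k m G t : (m + k)%N = N -> Past m G ->
  (P (G `&` tail m t) <= (expR (k%:R * c - l * t))%:E * P G)%E.
Proof.
elim: k m G t => [|k IHk] m G t mkN PG; have mG := mPast PG.
  (* With no sample left the sum is 0: either [t <= 0] and the exponential is at least 1, or the
     tail is empty. *)
  rewrite mul0r sub0r; have [t0|t0] := leP t 0.
    apply: (@le_trans _ _ (P G)).
      by rewrite le_measure ?inE//; apply: measurableI.
    rewrite -[leLHS]mul1e lee_wpmul2r// lee_fin -expR0 ler_expR.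
    by rewrite oppr_ge0 mulr_ge0_le0.
  rewrite (_ : tail m t = set0); first by rewrite setI0 measure0 mule_ge0// lee_fin expR_ge0.
  apply/seteqP; split => // om; rewrite /tail/= big1 ?leNgt ?t0// => i.
  by rewrite -[m]addn0 mkN leqNgt ltn_ord.
have mN : (m < N)%N by rewrite -mkN addnS ltnS leq_addr.
pose m' := Ordinal mN.
apply: (@le_trans _ _ (\sum_(a : M)
    P ((G `&` [set om | V m' om = a]) `&` tail m.+1 (t - v a)))%E).
  apply: le_measure_fin_cover.
  - exact: measurableI.
  - by move=> a; apply: measurableI => //; apply: measurableI.
  move=> om [Gom]; rewrite /tail/= (bigD1 m')//= => tom.
  exists (V m' om); split => //; rewrite lerBlDl (le_trans tom)// lerD2l.
  rewrite le_eqVlt; apply/orP; left; apply/eqP; apply: eq_bigl => i.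
  by rewrite andbC -(inj_eq val_inj)/= eq_sym -ltn_neqAle.
apply: (@le_trans _ _ (\sum_(a : M) (expR (k%:R * c - l * t))%:E *
    ((expR (l * v a))%:E * P (G `&` [set om | V m' om = a])))%E).
  apply: lee_sum => a _; rewrite muleA -EFinM -expRD.
  rewrite (_ : k%:R * c - l * t + l * v a = k%:R * c - l * (t - v a)); last by ring.
  apply: IHk; first by rewrite addSnnS.
  exact: (@PastS m' G a PG).
rewrite -ge0_sume_distrr; last by move=> a _; rewrite mule_ge0// lee_fin expR_ge0.
rewrite (_ : k.+1%:R * c - l * t = k%:R * c - l * t + c); last by rewrite -natr1; ring.
rewrite [expR (_ + c)]expRD EFinM -muleA; apply: lee_wpmul2l; first by rewrite lee_fin expR_ge0.
exact: (@Past_mgf m' G PG).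
Qed.

End chernoff.

Lemma fin_union_bound {d} {T : measurableType d} {R : realType}
    (mu : {measure set T -> \bar R}) {I : finType} (F : I -> set T) (b : R) :
  (forall i, measurable (F i)) -> (forall i, (mu (F i) <= b%:E)%E) ->
  exists A : set T, [/\ measurable A, (forall i, F i `<=` A) &
    (mu A <= (#|I|%:R * b)%:E)%E].
Proof.
move=> mF Fb; exists (\big[setU/set0]_(i : I) F i); split.
- exact: bigsetU_measurable.
- by move=> i x Fix; rewrite -bigcup_seq; exists i => //=; rewrite mem_index_enum.
- apply: (le_trans (le_measure_big_setU mu (index_enum I) mF)).
  rewrite (le_trans (lee_sum _ (fun i _ => Fb i)))// sumEFin lee_fin.
  by rewrite sumr_const mulr_natl.
Qed.

(** * Laws restricted to an event, and independence from the past *)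

Section joint_law.
Context {d d' : measure_display} {Om : measurableType d} {T : measurableType d'}
  {R : realType} (P : probability Om R).

(** Left unnormalized, this law of [Z] on the event [G] expresses conditioning without a separate
    case [P G = 0]. The measurability proofs are arguments so that the measure structure can be
    attached to the term. *)
Definition jlaw (G : set Om) (_ : measurable G) (Z : Om -> T)
    (_ : measurable_fun setT Z) (A : set T) : \bar R := P (G `&` Z @^-1` A).

Variables (G : set Om) (mG : measurable G) (Z : Om -> T) (mZ : measurable_fun setT Z).
Local Notation law := (jlaw mG mZ).

Let mpre (A : set T) : measurable A -> measurable (Z @^-1` A).
Proof. by move=> mA; rewrite -[X in measurable X]setTI; apply: mZ. Qed.

Let jlaw0 : law set0 = 0%E.
Proof. by rewrite /jlaw preimage_set0 setI0 measure0. Qed.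

Let jlaw_ge0 A : (0 <= law A)%E. Proof. by []. Qed.

Let jlaw_sigma_additive : semi_sigma_additive law.
Proof.
move=> F mF tF mUF; rewrite /jlaw preimage_bigcup setI_bigcupr.
apply: measure_semi_sigma_additive.
- by move=> n; apply: measurableI => //; exact: mpre.
- apply/trivIset_setIl/trivIsetP => /= i j _ _ ij; rewrite -preimage_setI.
  by move/trivIsetP : tF => /(_ _ _ _ _ ij) ->//; rewrite preimage_set0.
- rewrite -setI_bigcupr -preimage_bigcup; apply: measurableI => //; exact: mpre.
Qed.

HB.instance Definition _ := isMeasure.Build _ _ _ law
  jlaw0 jlaw_ge0 jlaw_sigma_additive.

Let jlaw_fin : fin_num_fun law.
Proof.
by move=> A mA; apply: fin_num_measure; apply: measurableI => //; exact: mpre.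
Qed.

HB.instance Definition _ := Measure_isFinite.Build _ _ _ law jlaw_fin.

End joint_law.
Arguments jlaw {d d' Om T R} P {G} mG {Z} mZ.

Section freezing.
Context {d d1 d2 : measure_display} {Om : measurableType d}
  {T1 : measurableType d1} {T2 : measurableType d2} {R : realType}
  (P : probability Om R) (W : probability T2 R) (X : Om -> T1)
  (mX : measurable_fun setT X).

Let mpre d' (T : measurableType d') (Z : Om -> T) (A : set T) :
  measurable_fun setT Z -> measurable A -> measurable (Z @^-1` A).
Proof. by move=> mZ mA; rewrite -[X in measurable X]setTI; apply: mZ. Qed.

(** A product measure is determined by its values on rectangles. This turns independence into
    integration over [Y] with [X] frozen. *)
Lemma freezing (G : set Om) (mG : measurable G) (Y : Om -> T2)
    (mY : measurable_fun setT Y) :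
  (forall A B, measurable A -> measurable B ->
    P (G `&` X @^-1` A `&` Y @^-1` B) = (P (G `&` X @^-1` A) * W B)%E) ->
  forall E : set (T1 * T2), measurable E ->
  P (G `&` [set om | E (X om, Y om)]) = (jlaw P mG mX \x W)%E E.
Proof.
move=> indep E mE; pose mXY := measurable_fun_pair mX mY.
rewrite -[LHS]/(jlaw P mG mXY E); symmetry.
have H0 := (@product_measure_unique _ _ _ _ _ (jlaw P mG mX) W (jlaw P mG mXY)).
apply: H0 => // A B mA mB.
rewrite /= /jlaw -indep//; congr (P _).
by apply/seteqP; split => om /=; tauto.
Qed.

Variables (N : nat) (Y : 'I_N -> Om -> T2).
Hypothesis mY : forall k, measurable_fun setT (Y k).

Definition future (m : nat) (B : 'I_N -> set T2) : set Om :=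
  [set om | forall k : 'I_N, (m <= k)%N -> B k (Y k om)].

Lemma measurable_future m B : (forall k, measurable (B k)) -> measurable (future m B).
Proof.
move=> mB; rewrite (_ : future m B = \big[setI/setT]_(k < N | (m <= k)%N) (Y k @^-1` B k)).
  by apply: bigsetI_measurable => k _; exact: mpre.
rewrite -bigcap_seq_cond; apply/seteqP; split => om /= H k.
  by move=> /andP[_ mk]; exact: H.
by move=> mk; apply: H; rewrite /= mem_index_enum.
Qed.

(* [G] may involve [X] and the [Y k] with [k < m] only. *)
Definition indep_past (m : nat) (G : set Om) : Prop := measurable G /\
  forall A B, measurable A -> (forall k, measurable (B k)) ->
  P (G `&` X @^-1` A `&` future m B) =
  (P (G `&` X @^-1` A) * (\prod_(k < N | (m <= k)%N) fine (W (B k)))%:E)%E.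

(** Inserting [B] at index [m] of the future events produces the factor [W B]. The sets [A1] and
    [B1] are carried along because [indep_pastS] tests an enlarged past against arbitrary events of
    [X] and of the future. *)
Lemma indep_past_current (m : 'I_N) G A1 B1 (A : set T1) (B : set T2) :
  indep_past m G -> measurable A1 -> (forall k, measurable (B1 k)) ->
  measurable A -> measurable B ->
  P (G `&` X @^-1` A1 `&` future m.+1 B1 `&` X @^-1` A `&` Y m @^-1` B) =
  (P (G `&` X @^-1` A1 `&` X @^-1` A) *
    (\prod_(k < N | (m.+1 <= k)%N) fine (W (B1 k)))%:E * W B)%E.
Proof.
move=> [mG GE] mA1 mB1 mA mB.
pose B2 k := if k == m then B else B1 k.
have -> : G `&` X @^-1` A1 `&` future m.+1 B1 `&` X @^-1` A `&` Y m @^-1` B =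
  G `&` X @^-1` (A1 `&` A) `&` future m B2.
  apply/seteqP; split => om /=.
    move=> [[[[Gom A1om] fom] Aom] Bom]; split => // k mk.
    rewrite /B2; case: eqP => [->//|/eqP km]; apply: fom.
    by rewrite ltn_neqAle eq_sym km.
  move=> [[Gom [A1om Aom]] fom]; split; last first.
    by have := fom m (leqnn _); rewrite /B2 eqxx.
  split => //; split => // k mk.
  by have := fom k (ltnW mk); rewrite /B2 ifN// -(inj_eq val_inj)/= gtn_eqF.
rewrite GE; [|exact: measurableI|by move=> k; rewrite /B2; case: ifP].
rewrite -setIA -preimage_setI -muleA; congr (_ * _)%E.
rewrite (bigD1 m)//= {1}/B2 eqxx mulrC EFinM fineK ?fin_num_measure//.
congr ((_)%:E * _)%E; apply: eq_big => k.
  by rewrite andbC -(inj_eq val_inj)/= eq_sym -ltn_neqAle.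
by move=> /andP[_ km]; rewrite /B2 ifN.
Qed.

Lemma indep_past_prod_law (m : 'I_N) G A1 B1 (mG1 : measurable (G `&` X @^-1` A1 `&` future
  m.+1 B1)) :
  indep_past m G -> measurable A1 -> (forall k, measurable (B1 k)) ->
  forall E : set (T1 * T2), measurable E ->
  P (G `&` X @^-1` A1 `&` future m.+1 B1 `&` [set om | E (X om, Y m om)]) =
  (jlaw P mG1 mX \x W)%E E.
Proof.
move=> GP mA1 mB1; apply: freezing => // A B mA mB.
rewrite indep_past_current//; congr (_ * _)%E.
have := @indep_past_current m G A1 B1 A setT GP mA1 mB1 mA measurableT.
by rewrite preimage_setT setIT probability_setT mule1.
Qed.

Lemma futureT m : future m (fun=> setT) = setT.
Proof. by apply/seteqP; split. Qed.

Lemma indep_past_prod_law0 (m : 'I_N) G (mG : measurable G) :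
  indep_past m G -> forall E : set (T1 * T2), measurable E ->
  P (G `&` [set om | E (X om, Y m om)]) = (jlaw P mG mX \x W)%E E.
Proof.
move=> GP; apply: freezing => // A B mA mB.
have := @indep_past_current m G setT (fun=> setT) A B GP measurableT (fun=> measurableT) mA mB.
rewrite futureT preimage_setT !setIT => ->; rewrite big1 ?mule1//.
by move=> k _; rewrite probability_setT.
Qed.

(** Both sides integrate the [W]-measure of the sections of [E] against a law of [X], once with the
    future event and once without it; by [indep_past_current] the first law is the constant [c]
    times the second. Thus [E] need not be a rectangle, as the level sets of the rounded summands
    require. *)
Lemma indep_pastS (m : 'I_N) G (E : set (T1 * T2)) : measurable E ->
  indep_past m G -> indep_past m.+1 (G `&` [set om | E (X om, Y m om)]).
Proof.
move=> mE GP; have mG := GP.1.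
have mXY := measurable_fun_pair mX (mY m).
have mpE : measurable [set om | E (X om, Y m om)] by exact: (mpre mXY mE).
split; first exact: measurableI.
move=> A B mA mB.
have mG0 : measurable (G `&` X @^-1` A `&` future m.+1 (fun=> setT)).
  apply: measurableI; last exact: measurable_future.
  by apply: measurableI => //; exact: mpre.
have mG1 : measurable (G `&` X @^-1` A `&` future m.+1 B).
  apply: measurableI; last exact: measurable_future.
  by apply: measurableI => //; exact: mpre.
rewrite [X in P (X `&` _)]setIAC [X in P X]setIAC (indep_past_prod_law mG1)//.
rewrite [X in (P X * _)%E]setIAC.
have := indep_past_prod_law mG0 GP mA (fun=> measurableT) mE.
rewrite {1}futureT setIT => ->.
set c := \prod_(_ < _ | _) _.
have c0 : 0 <= c by apply: prodr_ge0 => k _; rewrite fine_ge0.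
rewrite /product_measure1 (eq_measure_integral (mscale (NngNum c0) (jlaw P mG0 mX))).
  rewrite ge0_integral_mscale.
  - exact: muleC.
  - exact: measurableT.
  - exact: measurable_fun_xsection.
  - by move=> x _; exact: measure_ge0.
move=> A' mA' _.
change (P (G `&` X @^-1` A `&` future m.+1 B `&` X @^-1` A') =
  (c%:E * P (G `&` X @^-1` A `&` future m.+1 (fun=> setT) `&` X @^-1` A'))%E).
have := @indep_past_current m G A B A' setT GP mA mB mA' measurableT.
rewrite preimage_setT setIT probability_setT mule1 => ->.
by rewrite futureT setIT muleC.
Qed.

End freezing.

(** * Means and exponential moments of bounded functions *)

Section bounded_mean.
Context {d} {T : measurableType d} {R : realType} (W : probability T R).
Implicit Types g : T -> R.

Lemma bounded_integrable g b : measurable_fun setT g -> (forall y, `|g y| <= b) ->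
  W.-integrable setT (EFin \o g).
Proof.
move=> mg gb; apply: measurable_bounded_integrable => //.
  by rewrite (le_lt_trans (probability_le1 W measurableT))// ltry.
exists b; split; first exact: num_real.
by move=> x bx y _; rewrite /= (le_trans (gb y))// ltW.
Qed.

Lemma Rintegral_prob_cst (r : R) : (\int[W]_y r)%R = r.
Proof. by rewrite Rintegral_cst// [X in fine X]probability_setT mulr1. Qed.

Lemma Rintegral_between g a b : measurable_fun setT g -> (forall y, a <= g y <= b) ->
  a <= (\int[W]_y g y)%R <= b.
Proof.
move=> mg gab.
have gi : W.-integrable setT (EFin \o g).
  apply: (@bounded_integrable g (`|a| + `|b|)) => // y.
  have /andP[ga gb] := gab y; rewrite ler_norml; apply/andP; split.
    by rewrite opprD lerBlDr; have := ler_normlW (lexx `|a|);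
      have := lerNnormlW (lexx `|a|); have := normr_ge0 b; lra.
  by have := ler_norm b; have := normr_ge0 a; lra.
have ci r : W.-integrable setT (EFin \o (fun=> r : R)).
  exact: (@bounded_integrable (fun=> r) `|r|).
rewrite -[X in X <= _](Rintegral_prob_cst a) -[X in _ && (_ <= X)](Rintegral_prob_cst b).
by apply/andP; split; apply: le_Rintegral => // y _; have /andP[] := gab y.
Qed.

Lemma EFin_Rintegral g b : measurable_fun setT g -> (forall y, `|g y| <= b) ->
  (\int[W]_y (g y)%:E)%E = (\int[W]_y g y)%R%:E.
Proof.
move=> mg gb; rewrite /Rintegral fineK//; apply: integrable_fin_num => //.
exact: (bounded_integrable mg gb).
Qed.

Lemma Rintegral_sqr_eq0 g b : measurable_fun setT g -> (forall y, `|g y| <= b) ->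
  (\int[W]_y (g y) ^+ 2)%R = 0 -> ae_eq W setT (EFin \o g) (cst 0%E).
Proof.
move=> mg gb g0.
have mg2 : measurable_fun setT (EFin \o (fun y => g y ^+ 2)).
  by apply/measurable_EFinP; exact: measurable_funX.
have : ae_eq W setT (EFin \o (fun y => g y ^+ 2)) (cst 0%E).
  apply/ae_eq_integral_abs => //.
  rewrite (eq_integral (fun y => (g y ^+ 2)%:E)); last first.
    by move=> y _ /=; rewrite ger0_norm// sqr_ge0.
  rewrite (@EFin_Rintegral _ (b ^+ 2)) ?g0//; first exact: measurable_funX.
  by move=> y; rewrite normrX lerXn2r ?nnegrE// (le_trans _ (gb y)).
apply: filterS => y /= /(_ I) [/eqP]; rewrite sqrf_eq0 => /eqP -> _; by [].
Qed.

End bounded_mean.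

(** Since [expR (- u) >= 1 - u], it suffices that [(1 + u + 2 * u ^+ 2) * (1 - u) = 1 + u ^+ 2 * (1
    - 2 * u)] be at least 1. *)
Lemma expR_le_quadratic {R : realType} (u : R) : `|u| <= 1 / 2 ->
  expR u <= 1 + u + 2 * u ^+ 2.
Proof.
rewrite ler_norml => /andP[u1 u2].
have e1 : 1 - u <= expR (- u) by exact: expR_ge1Dx.
have e0 : 0 < 1 - u by lra.
have -> : expR u = (expR (- u))^-1 by rewrite expRN invrK.
rewrite (@le_trans _ _ (1 - u)^-1)// ?lef_pV2 ?posrE ?expR_gt0//.
rewrite -[leLHS]mul1r ler_pdivrMr//; nra.
Qed.

Section mgf.
Context {d} {T : measurableType d} {R : realType} (W : probability T R).
Variables (g : T -> R) (b l : R).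
Hypothesis mg : measurable_fun setT g.
Hypothesis gb : forall y, `|g y| <= b.

Let mexp : measurable_fun setT (fun y => (expR (l * g y))%:E).
Proof.
apply/measurable_EFinP; apply: measurableT_comp; first exact: measurable_expR.
exact: measurable_funM.
Qed.

(** Bounding the square in the quadratic estimate by [(l * b) ^+ 2] leaves [q], affine in [g], whose
    integral is [1 + 2 * (l * b) ^+ 2] because [g] has mean 0. *)
Lemma mgf_le : 0 <= b -> 0 <= l -> l * b <= 1 / 2 -> (\int[W]_y g y)%R = 0 ->
  (\int[W]_y (expR (l * g y))%:E <= (expR (2 * (l * b) ^+ 2))%:E)%E.
Proof.
move=> b0 l0 lb g0; pose q y := l * g y + (1 + 2 * (l * b) ^+ 2).
have mlg : measurable_fun setT (fun y => l * g y) by exact: measurable_funM.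
have lgb y : `|l * g y| <= l * b by rewrite normrM ger0_norm// ler_wpM2l.
have Lg y : expR (l * g y) <= q y.
  rewrite (le_trans (expR_le_quadratic _))//; first exact: (le_trans (lgb y)).
  have : (l * g y) ^+ 2 <= (l * b) ^+ 2.
    by rewrite -[leLHS]real_normK ?num_real// lerXn2r ?nnegrE// (le_trans _ (lgb y)).
  rewrite /q; lra.
have mq : measurable_fun setT q by exact: measurable_funD.
have qb y : `|q y| <= l * b + (1 + 2 * (l * b) ^+ 2).
  rewrite (le_trans (ler_normD _ _))// lerD// ger0_norm//.
  by rewrite addr_ge0// mulr_ge0// sqr_ge0.
apply: (@le_trans _ _ (\int[W]_y (q y)%:E)%E).
  apply: ge0_le_integral => //; last by move=> y _; rewrite lee_fin.
  exact/measurable_EFinP.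
rewrite (EFin_Rintegral W mq qb) lee_fin RintegralD//; last 2 first.
- exact: (bounded_integrable W mlg lgb).
- by apply: (@bounded_integrable _ _ _ W _ `|1 + 2 * (l * b) ^+ 2|).
rewrite RintegralZl//; last exact: (bounded_integrable W mg gb).
by rewrite g0 mulr0 add0r Rintegral_prob_cst expR_ge1Dx.
Qed.

(** Here [l] is unrestricted, which is what lets [sum_tail_null] take it arbitrarily large. *)
Lemma mgf_null : (\int[W]_y (g y) ^+ 2)%R = 0 ->
  (\int[W]_y (expR (l * g y))%:E = 1)%E.
Proof.
move=> g0; rewrite (@ae_eq_integral _ _ _ W setT (cst 1%E))//.
  by rewrite integral_cst// mul1e [LHS]probability_setT.
move/(Rintegral_sqr_eq0 mg gb): g0; apply: filterS => y /= /(_ I) [->] _.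
by rewrite mulr0 expR0.
Qed.

End mgf.

(** * Tail bounds for sums and means, one variable being frozen *)

Section concentration.
Context {d d1 d2 : measure_display} {Om : measurableType d}
  {T1 : measurableType d1} {T2 : measurableType d2} {R : realType}
  (P : probability Om R) (W : probability T2 R) (X : Om -> T1)
  (mX : measurable_fun setT X) (N : nat) (Y : 'I_N -> Om -> T2).
Hypothesis mY : forall k, measurable_fun setT (Y k).
Hypothesis indep0 : indep_past P W X Y 0 setT.

Section mgf_bound.
Variables (h : T1 * T2 -> R) (b e l c : R).
Hypothesis mh : measurable_fun setT h.
Hypothesis hb : forall q, `|h q| <= b.
Hypothesis e0 : 0 < e.
Hypothesis l0 : 0 <= l.
Hypothesis hmgf : forall x, (\int[W]_y (expR (l * h (x, y)))%:E <= (expR c)%:E)%E.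

(* [h] is rounded down to a grid of step [e], so that the summands take finitely
   many values while the bound on the moment generating function is kept. *)
Let n := Num.truncn ((b + b) / e).
Let lev q : 'I_n.+1 := inord (Num.truncn ((h q + b) / e)).
Let v (i : 'I_n.+1) : R := i%:R * e - b.

Let lev_def q : val (lev q) = Num.truncn ((h q + b) / e).
Proof.
rewrite /= inordK// ltnS le_truncn// ler_pM2r ?invr_gt0// lerD2r.
exact: le_trans (ler_norm _) (hb q).
Qed.

Let hDb_ge0 q : 0 <= (h q + b) / e.
Proof.
apply: divr_ge0; last exact: ltW.
by rewrite -lerBlDr sub0r; have := hb q; rewrite ler_norml => /andP[].
Qed.

Let levP q i : lev q = i <-> v i <= h q < v i + e.
Proof.
have -> : (v i <= h q < v i + e) = (i%:R <= (h q + b) / e < i.+1%:R).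
  rewrite ler_pdivlMr// ltr_pdivrMr// -natr1 mulrDl mul1r /v.
  by rewrite lerBlDr -ltrBrDr; congr (_ && (_ < _)); ring.
split=> [<-|/truncn_def iE].
  by rewrite lev_def truncn_itv.
by apply/val_inj; rewrite lev_def.
Qed.

Let E i := [set q | lev q = i].

Let mE i : measurable (E i).
Proof.
rewrite (_ : E i = h @^-1` `[v i, v i + e[).
  by rewrite -[X in measurable X]setTI; exact: mh.
by apply/seteqP; split => q /=; rewrite in_itv/=; apply levP.
Qed.

Let sum_E q : \sum_i expR (l * v i) * \1_(E i) q = expR (l * v (lev q)).
Proof.
rewrite (bigD1 (lev q))//= indicE mem_set// mulr1 big1 ?addr0// => i iq.
by rewrite indicE memNset ?mulr0// => /esym/eqP; exact/negP.
Qed.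

(** This is [Past_mgf] for the rounded summands. The sum over levels is an integral against a
    product law; rounding down only decreases the exponential, as [0 <= l]; Tonelli with the first
    variable frozen then reduces to [hmgf]. *)
Let step (m : 'I_N) G : indep_past P W X Y m G ->
  (\sum_i (expR (l * v i))%:E * P (G `&` [set om | lev (X om, Y m om) = i])
   <= (expR c)%:E * P G)%E.
Proof.
move=> GP; have mG := GP.1; pose nu := jlaw P mG mX.
have mexp : measurable_fun setT (fun q => (expR (l * h q))%:E).
  apply/measurable_EFinP; apply: measurableT_comp; first exact: measurable_expR.
  exact: measurable_funM.
have term i : ((expR (l * v i))%:E * P (G `&` [set om | lev (X om, Y m om) = i]) =
    \int[nu \x W]_q (expR (l * v i) * \1_(E i) q)%:E)%E.
  rewrite (indep_past_prod_law0 mX mY mG GP (mE i)).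
  under eq_integral do rewrite EFinM.
  rewrite ge0_integralZl ?lee_fin ?expR_ge0//; first by rewrite integral_indic// setIT.
  by apply/measurable_EFinP; exact: measurable_indic.
under eq_bigr do rewrite term.
rewrite -ge0_integral_sum//; last first.
  by move=> i; apply/measurable_EFinP; exact: measurable_funM.
apply: (@le_trans _ _ (\int[nu \x W]_q (expR (l * h q))%:E)%E).
  apply: ge0_le_integral => //.
  - by move=> q _; rewrite sumEFin lee_fin sum_E expR_ge0.
  - under eq_fun do rewrite sumEFin sum_E.
    apply/measurable_EFinP; exact: (measurable_fun_finite_valued (fun i => expR (l * v i)) mE).
  - move=> q _; rewrite sumEFin lee_fin sum_E ler_expR ler_wpM2l//.
    by have /levP/andP[] := erefl (lev q).
rewrite fubini_tonelli1//.
apply: (@le_trans _ _ (\int[nu]_x (expR c)%:E)%E).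
  apply: ge0_le_integral => //.
  - by move=> x _; apply: integral_ge0.
  - exact: measurable_fun_fubini_tonelli_F.
  - by move=> x _; exact: hmgf.
by rewrite integral_cst//= /jlaw preimage_setT setIT.
Qed.

(** Rounding loses at most [e] per summand, so the threshold [N * (t + e)] for the sum becomes
    [N * t] for the rounded sum. *)
Lemma sum_tail_mgf (t : R) :
  (P [set om | (N%:R * (t + e) <= \sum_k h (X om, Y k om))%R] <=
    (expR (N%:R * (c - l * t)))%:E)%E.
Proof.
have mlev k i : measurable [set om | lev (X om, Y k om) = i].
  rewrite -[X in measurable X]setTI.
  exact: (measurable_fun_pair mX (mY k) measurableT (mE i)).
have mS : measurable_fun setT (fun om => \sum_k h (X om, Y k om)).
  apply: measurable_sum => k; apply: (measurableT_comp mh).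
  exact: measurable_fun_pair.
have := @chernoff_tail _ Om R P N _ (fun k om => lev (X om, Y k om)) v l c
  (indep_past P W X Y) l0 mlev (fun m G GP => GP.1) _ step N 0 setT (N%:R * t) (add0n N) indep0.
rewrite probability_setT mule1 => /(_ (fun m G i GP => indep_pastS mX mY (mE i) GP)).
rewrite mulrCA -mulrBr; apply: le_trans.
rewrite setTI le_measure ?inE//.
- rewrite (_ : [set om | _] = (fun om => \sum_k h (X om, Y k om)) @^-1` `[N%:R * (t + e), +oo[).
    by rewrite -[X in measurable X]setTI; exact: mS.
  by apply/seteqP; split => om /=; rewrite in_itv/= andbT.
- have mSv : measurable_fun setT (fun om => \sum_(k < N | (0 <= k)%N) v (lev (X om, Y k om))).
    by apply: measurable_sum => k; exact: (measurable_fun_finite_valued v (mlev k)).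
  rewrite (_ : [set om | _] = (fun om => \sum_(k < N | (0 <= k)%N) v (lev (X om, Y k om)))
    @^-1` `[N%:R * t, +oo[).
    by rewrite -[X in measurable X]setTI; exact: mSv.
  by apply/seteqP; split => om /=; rewrite in_itv/= andbT.
move=> om /= H; rewrite -(lerD2r (N%:R * e)) -mulrDr (le_trans H)//.
rewrite -[N in N%:R * e]card_ord mulr_natl -sumr_const -big_split/= ler_sum// => k _.
by have /levP/andP[_ /ltW] := erefl (lev (X om, Y k om)).
Qed.
End mgf_bound.

Variables (h : T1 * T2 -> R) (b t : R).
Hypothesis mh : measurable_fun setT h.
Hypothesis b0 : 0 < b.
Hypothesis hb : forall q, `|h q| <= b.
Hypothesis t0 : 0 < t.

Let mhx x : measurable_fun setT (fun y => h (x, y)).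
Proof. by apply: (measurableT_comp mh); exact: pair1_measurable. Qed.

Lemma sum_tail_centered : t <= 4 * b -> (forall x, (\int[W]_y h (x, y))%R = 0) ->
  (P [set om | (N%:R * t <= \sum_k h (X om, Y k om))%R] <=
    (expR (- (N%:R * t ^+ 2 / (32 * b ^+ 2))))%:E)%E.
Proof.
(* Half of [t] pays for the rounding, so the exponent per sample is [2 * (l * b) ^+ 2 - l * t / 2].
   This [l] minimizes it, with value [- t ^+ 2 / (32 * b ^+ 2)], and [t <= 4 * b] amounts to
   [l * b <= 1 / 2]. *)
move=> tb h0; pose l := t / (8 * b ^+ 2).
have b20 : 0 < 8 * b ^+ 2 by rewrite mulr_gt0// exprn_gt0.
have l0 : 0 <= l by rewrite divr_ge0 ?ltW.
have lb : l * b <= 1 / 2.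
  rewrite /l mulrAC ler_pdivrMr// (_ : 1 / 2 * _ = 4 * b * b); last by field.
  by rewrite ler_wpM2r// ltW.
have := sum_tail_mgf mh hb (divr_gt0 t0 (ltr0n _ 2)) l0
  (fun x => mgf_le (@mhx x) (fun y => hb (x, y)) (ltW b0) l0 lb (h0 x)) (t / 2).
rewrite -splitr => /le_trans; apply; rewrite lee_fin ler_expR le_eqVlt; apply/orP; left.
by apply/eqP; rewrite /l; field; rewrite gt_eqF.
Qed.

(** The summands vanish almost surely, so the exponential bound holds with [c = 0] for every
    [l >= 0]. Given [e > 0], taking [l] with total exponent [- e^-1] bounds the probability by [e],
    since [expR e^-1 >= e^-1]. *)
Lemma sum_tail_null : (0 < N)%N -> (forall x, (\int[W]_y (h (x, y)) ^+ 2)%R = 0) ->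
  P [set om | N%:R * t <= \sum_k h (X om, Y k om)] = 0%E.
Proof.
move=> N0 h0; set A := [set om | _].
have Al l : 0 <= l -> (P A <= (expR (- (N%:R * (l * (t / 2)))))%:E)%E.
  move=> l0; have := sum_tail_mgf (c := 0) mh hb (divr_gt0 t0 (ltr0n _ 2)) l0 _ (t / 2).
  rewrite -splitr sub0r mulrN; apply => x.
  by rewrite expR0 (mgf_null l (@mhx x) (fun y => hb (x, y)))//.
apply/eqP; rewrite eq_le measure_ge0 andbT.
apply/lee_addgt0Pr => e e0; rewrite add0e.
have Nt : 0 < N%:R * (t / 2) by rewrite mulr_gt0// ?ltr0n// divr_gt0.
apply: (le_trans (Al (e^-1 / (N%:R * (t / 2))) _)).
  by rewrite divr_ge0 ?ltW// invr_gt0.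
rewrite lee_fin (_ : N%:R * _ = e^-1); last by field; rewrite ?gt_eqF// ltr0n.
rewrite expRN -[leRHS]invrK lef_pV2 ?posrE ?expR_gt0 ?invr_gt0//.
by rewrite (le_trans _ (expR_ge1Dx _))// lerDr.
Qed.
End concentration.

Section mean_deviation.
Context {d d1 d2 : measure_display} {Om : measurableType d}
  {T1 : measurableType d1} {T2 : measurableType d2} {R : realType}
  (P : probability Om R) (W : probability T2 R) (X : Om -> T1)
  (mX : measurable_fun setT X) (N : nat) (Y : 'I_N -> Om -> T2).
Hypothesis mY : forall k, measurable_fun setT (Y k).
Hypothesis indep0 : indep_past P W X Y 0 setT.
Hypothesis N0 : (0 < N)%N.

Definition mean_dev (h : T1 * T2 -> R) (t : R) : set Om :=
  [set om | t <= `|N%:R^-1 * \sum_k h (X om, Y k om)|].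

Variables (h : T1 * T2 -> R) (b t : R).
Hypothesis mh : measurable_fun setT h.
Hypothesis b0 : 0 < b.
Hypothesis hb : forall q, `|h q| <= b.
Hypothesis t0 : 0 < t.

Lemma measurable_mean_dev : measurable (mean_dev h t).
Proof.
have mS : measurable_fun setT (fun om => `|N%:R^-1 * \sum_k h (X om, Y k om)|).
  apply: measurableT_comp => //; apply: measurable_funM => //.
  apply: measurable_sum => k; apply: (measurableT_comp mh).
  exact: measurable_fun_pair.
rewrite (_ : mean_dev h t = (fun om => `|N%:R^-1 * \sum_k h (X om, Y k om)|) @^-1` `[t, +oo[).
  by rewrite -[X in measurable X]setTI; exact: mS.
by apply/seteqP; split => om /=; rewrite in_itv/= andbT.
Qed.

Let mh' : measurable_fun setT (fun q => - h q).
Proof. exact: measurable_funN. Qed.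

Let hb' q : `|- h q| <= b. Proof. by rewrite normrN. Qed.

Let mtail (g : T1 * T2 -> R) : measurable_fun setT g ->
  measurable [set om | N%:R * t <= \sum_k g (X om, Y k om)].
Proof.
move=> mg; have mS : measurable_fun setT (fun om => \sum_k g (X om, Y k om)).
  apply: measurable_sum => k; apply: (measurableT_comp mg).
  exact: measurable_fun_pair.
rewrite (_ : [set om | _] = (fun om => \sum_k g (X om, Y k om)) @^-1` `[N%:R * t, +oo[).
  by rewrite -[X in measurable X]setTI; exact: mS.
by apply/seteqP; split => om /=; rewrite in_itv/= andbT.
Qed.

Let le_mean_dev : (P (mean_dev h t) <=
  P [set om | (N%:R * t <= \sum_k h (X om, Y k om))%R] +
  P [set om | (N%:R * t <= \sum_k - h (X om, Y k om))%R])%E.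
Proof.
apply: le_trans (measureU2 P (mtail mh) (mtail mh')).
rewrite le_measure ?inE//; first exact: measurable_mean_dev.
  by apply: measurableU; [exact: mtail|exact: (mtail mh')].
move=> om; rewrite /mean_dev/= normrM ger0_norm ?invr_ge0//.
rewrite mulrC ler_pdivlMr ?ltr0n// mulrC => tS.
have [S0|S0] := leP 0 (\sum_k h (X om, Y k om)).
  by left; rewrite (le_trans tS)// ger0_norm.
by right; rewrite sumrN (le_trans tS)// ltr0_norm.
Qed.

Lemma mean_dev_centered : t <= 4 * b -> (forall x, (\int[W]_y h (x, y))%R = 0) ->
  (P (mean_dev h t) <= (2 * expR (- (N%:R * t ^+ 2 / (32 * b ^+ 2))))%:E)%E.
Proof.
move=> tb h0; apply: (le_trans le_mean_dev).
rewrite [2 * expR _]mulr_natl mulr2n EFinD; apply: leeD.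
  exact: (sum_tail_centered mX mY indep0 mh b0 hb t0 tb h0).
apply: (sum_tail_centered mX mY indep0 mh' b0 hb' t0 tb) => x.
have mhx : measurable_fun setT (fun y => h (x, y)).
  by apply: (measurableT_comp mh); exact: pair1_measurable.
under eq_Rintegral do rewrite -mulN1r.
by rewrite RintegralZl ?h0 ?mulr0//; exact: (bounded_integrable W mhx (fun y => hb (x, y))).
Qed.

Lemma mean_dev_null : (forall x, (\int[W]_y (h (x, y)) ^+ 2)%R = 0) ->
  P (mean_dev h t) = 0%E.
Proof.
move=> h0; apply/eqP; rewrite eq_le measure_ge0 andbT (le_trans le_mean_dev)//.
rewrite (sum_tail_null mX mY indep0 mh hb t0)// add0e.
rewrite (sum_tail_null mX mY indep0 mh' hb' t0)// => x.
by under eq_Rintegral do rewrite sqrrN.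
Qed.
End mean_deviation.

(** * The three families of samples as instances of the independence scheme *)

Section sample_independence.
Context {R : realType} {dx dy : nat} {S : finType} (pw : S -> R)
  (Q : probability (@Borel R dx) R) (W : probability (@Borel R dy) R)
  {N1 N2 N3 : nat} {d0 : measure_display} {Om : measurableType d0}
  (P : probability Om R) (sx : 'I_N1 -> Om -> S)
  (x1 : 'I_N2 -> Om -> 'rV[R]_dx) (x2 : 'I_N3 -> Om -> 'rV[R]_dy).
Hypothesis pw0 : forall s, 0 < pw s.
Hypothesis pw1 : \sum_s pw s = 1.
Hypothesis iid : iid_samples pw Q W P sx x1 x2.

Lemma iid_measurable1 j : measurable_fun setT (x1 j : Om -> @Borel R dx).
Proof. by case: iid => _ m1 _ _ _ B mB; rewrite setTI; exact: m1. Qed.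

Lemma iid_measurable2 k : measurable_fun setT (x2 k : Om -> @Borel R dy).
Proof. by case: iid => _ _ m2 _ _ B mB; rewrite setTI; exact: m2. Qed.

Lemma iid_measurable0 i s : measurable_fun setT (fun om => sx i om == s).
Proof.
case: iid => m0 _ _ _; apply: (@measurable_fun_bool _ _ _ _ true); rewrite setTI.
rewrite (_ : _ @^-1` _ = [set om | sx i om = s]); first exact: m0.
by apply/seteqP; split => om /= /eqP.
Qed.

Lemma iid_prod (A : 'I_N1 -> {set S}) (B : 'I_N2 -> set (@Borel R dx))
    (C : 'I_N3 -> set (@Borel R dy)) :
  (forall j, measurable (B j)) -> (forall k, measurable (C k)) ->
  P [set om | [/\ forall i, sx i om \in A i, forall j, B j (x1 j om) &
    forall k, C k (x2 k om)]] =
  ((\prod_(i < N1) \sum_(s in A i) pw s) *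
   (\prod_(j < N2) fine (Q (B j))) * (\prod_(k < N3) fine (W (C k))))%:E.
Proof.
move=> mB mC; case: iid => _ _ _ <-//; congr (P _); apply/seteqP; split => om /=.
  by move=> [HA HB HC]; split; [split|] => i _; [exact: HA|exact: HB|exact: HC].
by move=> [[HA HB] HC]; split => i; [exact: HA|exact: HB|exact: HC].
Qed.

(** The outer samples enter through the indicators of one atom at a time, which are Bernoulli
    variables. Nothing is frozen, hence the constant variable in [unit]. *)
Lemma iid_indep0 (s : S) :
  indep_past P (bernoulli_prob (pw s)) (fun _ : Om => tt)
    (fun i om => sx i om == s) 0 setT.
Proof.
have pw_le1 : pw s <= 1.
  by rewrite -pw1 (bigD1 s)//= lerDl sumr_ge0// => s' _; exact: ltW.
split => // A B mA mB; rewrite setTI.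
have [At|At] := pselect (A tt); last first.
  rewrite (_ : _ @^-1` A = set0); first by rewrite set0I measure0 mul0e.
  by apply/seteqP; split.
rewrite (_ : _ @^-1` A = setT); last by apply/seteqP; split.
rewrite setTI probability_setT mul1e.
(* A subset of [bool] pulls back to the set of atoms whose total weight is its Bernoulli mass. *)
have := iid_prod (fun i => [set s' | (s' == s) \in B i]%SET) (fun=> measurableT)
  (fun=> measurableT).
rewrite (_ : [set om | _] = future (fun i om => sx i om == s) 0 B); last first.
  apply/seteqP; split => om /=.
    by move=> [H _ _] i _; have := H i; rewrite finset.inE => /set_mem.
  by move=> H; split => [i|//|//]; rewrite finset.inE; apply/mem_set; exact: H.
move=> ->; congr (_%:E).
rewrite [X in _ * X]big1 ?mulr1; last by move=> k _; rewrite probability_setT.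
rewrite [X in _ * X]big1 ?mulr1; last by move=> k _; rewrite probability_setT.
apply: eq_bigr => i _; rewrite -[RHS]/(fine (bernoulli_prob (pw s) (B i))) bernoulli_probE
  ?(ltW (pw0 s))//= /dirac !indicE.
have -> : unstable.onem (pw s) = \sum_(s' | s' != s) pw s'.
  by rewrite /unstable.onem -[X in X - _]pw1 (bigD1 s)//= addrC addrK.
under eq_bigl do rewrite finset.inE.
rewrite (bigID (pred1 s))/=; congr (_ + _).
  rewrite (eq_bigl (fun s' => (s' == s) && (true \in B i))); last first.
    by move=> s'; rewrite andbC; case: eqP.
  case: (true \in B i); last by rewrite mulr0 big_pred0// => s'; rewrite andbF.
  by under eq_bigl do rewrite andbT; rewrite big_pred1_eq mulr1.
rewrite (eq_bigl (fun s' => (s' != s) && (false \in B i))); last first.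
  by move=> s'; rewrite andbC; case: eqP.
case: (false \in B i); last by rewrite mulr0 big_pred0// => s'; rewrite andbF.
by rewrite mulr1; apply: eq_bigl => s'; rewrite andbT.
Qed.

Lemma iid_indep1 :
  indep_past P Q (fun _ : Om => tt) (x1 : 'I_N2 -> Om -> @Borel R dx) 0 setT.
Proof.
split => // A B mA mB; rewrite setTI.
have [At|At] := pselect (A tt); last first.
  rewrite (_ : _ @^-1` A = set0); first by rewrite set0I measure0 mul0e.
  by apply/seteqP; split.
rewrite (_ : _ @^-1` A = setT); last by apply/seteqP; split.
rewrite setTI probability_setT mul1e.
have := iid_prod (fun=> finset.setT) mB (fun=> measurableT).
rewrite (_ : [set om | _] = future (x1 : 'I_N2 -> Om -> @Borel R dx) 0 B); last first.
  apply/seteqP; split => om /=; first by move=> [_ H _] j _; exact: H.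
  by move=> H; split => [i|j|k]; [rewrite finset.inE|exact: H|].
move=> ->; congr (_%:E).
rewrite big1 ?mul1r; last first.
  by move=> i _; rewrite -[RHS]pw1; apply: eq_bigl => s; rewrite finset.inE.
by rewrite [X in _ * X]big1 ?mulr1// => k _; rewrite probability_setT.
Qed.

Lemma iid_indep2 (j : 'I_N2) :
  indep_past P W (x1 j : Om -> @Borel R dx) (x2 : 'I_N3 -> Om -> @Borel R dy) 0 setT.
Proof.
have key A C : measurable A -> (forall k, measurable (C k)) ->
    P ((x1 j : Om -> @Borel R dx) @^-1` A `&` future (x2 : 'I_N3 -> Om -> @Borel R dy) 0 C) =
    (fine (Q A) * \prod_(k < N3) fine (W (C k)))%:E.
  move=> mA mC; pose B i := if i == j then A else setT.
  have mB i : measurable (B i) by rewrite /B; case: ifP.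
  have := iid_prod (fun=> finset.setT) mB mC.
  rewrite (_ : [set om | _] = (x1 j : Om -> @Borel R dx) @^-1` A `&` future (x2 : 'I_N3 -> Om
    -> @Borel R dy) 0 C).
    move=> ->; congr (_%:E).
    rewrite big1 ?mul1r; last first.
      by move=> i _; rewrite -[RHS]pw1; apply: eq_bigl => s; rewrite finset.inE.
    rewrite (bigD1 j)//= {1}/B eqxx big1 ?mulr1// => i ij.
    by rewrite /B (negbTE ij) probability_setT.
  apply/seteqP; split => om /=.
    by move=> [_ /(_ j)]; rewrite /B eqxx => H1 H2; split => // k _; exact: H2.
  move=> [H1 H2]; split => [i|i|k]; first by rewrite finset.inE.
    by rewrite /B; case: eqP => // ->.
  exact: H2.
split => // A C mA mC; rewrite setTI key// EFinM; congr (_ * _)%E.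
have := @key A (fun=> setT) mA (fun=> measurableT).
rewrite futureT setIT => ->; rewrite big1 ?mulr1// => k _.
by rewrite probability_setT.
Qed.

End sample_independence.

Section pair_deviation.
Context {d d1 d2 : measure_display} {Om : measurableType d}
  {T1 : measurableType d1} {T2 : measurableType d2} {R : realType}
  (P : probability Om R) (W : probability T2 R) (X : Om -> T1)
  (mX : measurable_fun setT X) (N : nat) (Y : 'I_N -> Om -> T2).
Hypothesis mY : forall k, measurable_fun setT (Y k).
Hypothesis indep0 : indep_past P W X Y 0 setT.
Hypothesis N0 : (0 < N)%N.

(** In the applications [h] and [h'] are one summand at two close parameters. The value and the
    increment get separate scales [t] and [r], because increments have a much smaller range. *)
Definition pair_dev (h h' : T1 * T2 -> R) (t r : R) : set Om :=
  mean_dev X Y h t `|` mean_dev X Y (h \- h') r.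

Variables (h h' : T1 * T2 -> R) (b b' t r K : R).
Hypothesis mh : measurable_fun setT h.
Hypothesis mh' : measurable_fun setT h'.
Hypothesis b0 : 0 < b.
Hypothesis b'0 : 0 < b'.
Hypothesis hb : forall q, `|h q| <= b.
Hypothesis h'b : forall q, `|h' q| <= b.
Hypothesis hhb : forall q, `|h q - h' q| <= b'.
Hypothesis t0 : 0 < t.
Hypothesis r0 : 0 < r.

Let mhh : measurable_fun setT (h \- h').
Proof. exact: measurable_funB. Qed.

Let mhx (g : T1 * T2 -> R) x : measurable_fun setT g -> measurable_fun setT (fun y => g (x, y)).
Proof. by move=> mg; apply: (measurableT_comp mg); exact: pair1_measurable. Qed.

Let mdev : measurable (mean_dev X Y h t).
Proof. exact: measurable_mean_dev. Qed.

Let mdev' : measurable (mean_dev X Y (h \- h') r).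
Proof. exact: measurable_mean_dev. Qed.

Lemma measurable_pair_dev : measurable (pair_dev h h' t r).
Proof. exact: measurableU. Qed.

Let le_pair_dev : (P (pair_dev h h' t r) <=
  P (mean_dev X Y h t) + P (mean_dev X Y (h \- h')%R r))%E.
Proof. exact: (measureU2 P mdev mdev'). Qed.

Lemma pair_dev_null : (forall x, (\int[W]_y (h (x, y)) ^+ 2)%R = 0) ->
  (forall x, (\int[W]_y (h' (x, y)) ^+ 2)%R = 0) -> P (pair_dev h h' t r) = 0%E.
Proof.
move=> h0 h'0; apply/eqP; rewrite eq_le measure_ge0 andbT.
apply: (le_trans le_pair_dev).
rewrite (mean_dev_null mX mY indep0 N0 mh hb t0 h0) add0e.
rewrite (mean_dev_null mX mY indep0 N0 mhh hhb r0)// => x.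
(* No variance of a difference is assumed to vanish; it does because both functions are 0 almost
   everywhere. *)
have H : ae_eq W setT (EFin \o (fun y => (h (x, y) - h' (x, y)) ^+ 2)) (cst 0%E).
  have H1 := Rintegral_sqr_eq0 (mhx x mh) (fun y => hb (x, y)) (h0 x).
  have H2 := Rintegral_sqr_eq0 (mhx x mh') (fun y => h'b (x, y)) (h'0 x).
  apply: filterS2 H1 H2 => y /= /(_ I)[->] /(_ I)[->] _.
  by rewrite subrr expr0n.
have E : (\int[W]_y ((h (x, y) - h' (x, y)) ^+ 2)%:E = \int[W]_y (cst 0 y))%E.
  apply: ae_eq_integral => //.
  apply/measurable_EFinP; apply: measurable_funX; exact: (mhx x mhh).
by rewrite /Rintegral [X in fine X]E integral0.
Qed.

Lemma pair_dev_centered : t <= 4 * b -> r <= 4 * b' ->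
  K <= t ^+ 2 / (32 * b ^+ 2) -> K <= r ^+ 2 / (32 * b' ^+ 2) ->
  (forall x, (\int[W]_y h (x, y))%R = 0) -> (forall x, (\int[W]_y h' (x, y))%R = 0) ->
  (P (pair_dev h h' t r) <= (4 * expR (- (N%:R * K)))%:E)%E.
Proof.
move=> tb rb' Kt Kr h0 h'0.
apply: (le_trans le_pair_dev).
have H c : K <= c -> expR (- (N%:R * c)) <= expR (- (N%:R * K)).
  by move=> Kc; rewrite ler_expR lerN2 ler_wpM2l.
have -> : 4 * expR (- (N%:R * K)) = 2 * expR (- (N%:R * K)) + 2 * expR (- (N%:R * K)) by ring.
rewrite EFinD; apply: leeD.
  apply: (le_trans (mean_dev_centered mX mY indep0 N0 mh b0 hb t0 tb h0)).
  by rewrite lee_fin ler_wpM2l// -mulrA H.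
have hh0 x : (\int[W]_y (h \- h') (x, y))%R = 0.
  rewrite RintegralB ?h0 ?h'0 ?subrr//.
    exact: (bounded_integrable W (mhx x mh) (fun y => hb (x, y))).
  exact: (bounded_integrable W (mhx x mh') (fun y => h'b (x, y))).
apply: (le_trans (mean_dev_centered mX mY indep0 N0 mhh b'0 hhb r0 rb' hh0)).
by rewrite lee_fin ler_wpM2l// -mulrA H.
Qed.

End pair_deviation.

(** * Second differences and nets *)

Section second_differences.
Context {R : realType}.
Implicit Types a b x y L : R.

Lemma ler_dist_ln a b : 1 <= a -> 1 <= b -> `|ln a - ln b| <= `|a - b|.
Proof.
wlog ab : a b / b <= a.
  move=> H a1 b1; have [/H->//|/ltW/H ba] := leP b a.
  by rewrite distrC [X in _ <= X]distrC ba.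
move=> a1 b1; have a0 : 0 < a by lra.
have b0 : 0 < b by lra.
rewrite !ger0_norm ?subr_ge0 ?ler_ln ?posrE//.
have H := expR_ge1Dx (ln (a / b)); rewrite lnK ?posrE ?divr_gt0// in H.
rewrite -ln_div ?posrE// -(lerD2l 1) (le_trans H)// ler_pdivrMr//.
nra.
Qed.

(** The four logarithms merge into [ln (a' * b) - ln (a * b')], both arguments being at least 1,
    where [ln] is 1-Lipschitz. The difference [a' * b - a * b'] is then a second difference weighted
    by [b] plus a product of two first differences. *)
Lemma ler_dist2_ln a' a b' b L : 1 <= a' -> 1 <= a -> 1 <= b' -> 1 <= b -> b <= L ->
  `|(ln a' - ln a) - (ln b' - ln b)| <=
  L * `|(a' - a) - (b' - b)| + `|a - b| * `|b' - b|.
Proof.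
move=> a'1 a1 b'1 b1 bL.
have [pa' pa pb' pb] : [/\ 0 < a', 0 < a, 0 < b' & 0 < b] by split; lra.
have -> : (ln a' - ln a) - (ln b' - ln b) = ln (a' * b) - ln (a * b').
  by rewrite !lnM ?posrE//; ring.
rewrite (le_trans (ler_dist_ln _ _)) ?mulr_ege1//.
have -> : a' * b - a * b' = b * ((a' - a) - (b' - b)) + (a - b) * (b - b') by ring.
rewrite (le_trans (ler_normD _ _))// !normrM [`|b - b'|]distrC lerD2r.
by rewrite ler_wpM2r// ger0_norm// ltW.
Qed.

Lemma ler_dist_expR x y c : x <= c -> y <= c -> `|expR x - expR y| <= expR c * `|x - y|.
Proof.
wlog xy : x y / y <= x.
  move=> H x1 y1; have [/H->//|/ltW/H yx] := leP y x.
  by rewrite distrC [`|x - y|]distrC yx.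
move=> xc yc; rewrite !ger0_norm ?subr_ge0 ?ler_expR//.
have -> : expR y = expR x * expR (y - x) by rewrite -expRD addrC subrK.
rewrite -{1}[expR x]mulr1 -mulrBr ler_pM ?expR_ge0 ?ler_expR//.
  by rewrite subr_ge0 -expR0 ler_expR subr_le0.
by have := expR_ge1Dx (y - x); lra.
Qed.

(** Factoring [expR x] and [expR y] out of the increments gives a product of two first differences
    plus [expR y] times a difference of exponentials of increments, themselves at most [c]. *)
Lemma ler_dist2_expR x' x y' y c : 0 <= x' <= c -> 0 <= x <= c ->
  0 <= y' <= c -> 0 <= y <= c ->
  `|(expR x' - expR x) - (expR y' - expR y)| <=
  expR c ^+ 2 * (`|x - y| * `|x' - x| + `|(x' - x) - (y' - y)|).
Proof.
move=> /andP[x'0 x'c] /andP[x0 xc] /andP[y'0 y'c] /andP[y0 yc].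
have -> : (expR x' - expR x) - (expR y' - expR y) =
    (expR x - expR y) * (expR (x' - x) - expR 0) +
    expR y * (expR (x' - x) - expR (y' - y)).
  by rewrite expR0 mulrBr mulrBl !mulrBr -!expRD !mulr1 [y + (y' - y)]addrC
    [x + (x' - x)]addrC !subrK; ring.
have c0 : 0 <= c by lra.
rewrite [X in _ <= X]mulrDr (le_trans (ler_normD _ _))// !normrM lerD//.
  rewrite expr2 mulrACA ler_pM//; first exact: ler_dist_expR.
  by rewrite -[X in _ * `|X|]subr0 ler_dist_expR//; lra.
rewrite expr2 -mulrA; apply: ler_pM => //.
  by rewrite ger0_norm ?expR_ge0// ler_expR.
by apply: ler_dist_expR; lra.
Qed.

End second_differences.

Section averages.
Context {R : realType}.

Lemma ler_norm_mean (N : nat) (f : 'I_N -> R) m : (0 < N)%N ->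
  (forall i, `|f i| <= m) -> `|N%:R^-1 * \sum_i f i| <= m.
Proof.
move=> N0 fm; rewrite normrM ger0_norm ?invr_ge0// mulrC ler_pdivrMr ?ltr0n//.
rewrite (le_trans (ler_norm_sum _ _ _))// (le_trans (ler_sum _ (fun i _ => fm i)))//.
by rewrite sumr_const card_ord mulr_natr.
Qed.

Lemma mean_between (N : nat) (f : 'I_N -> R) a b : (0 < N)%N ->
  (forall i, a <= f i <= b) -> a <= N%:R^-1 * \sum_i f i <= b.
Proof.
move=> N0 fab; rewrite mulrC ler_pdivrMr ?ler_pdivlMr ?ltr0n//.
have e (c : R) : c * N%:R = \sum_(i < N) c by rewrite sumr_const card_ord mulr_natr.
by rewrite !e; apply/andP; split; apply: ler_sum => i _; have /andP[] := fab i.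
Qed.

Lemma wsum_between (I : finType) (A : pred I) (w f : I -> R) a b :
  (forall i, i \in A -> 0 <= w i) -> \sum_(i in A) w i = 1 ->
  (forall i, i \in A -> a <= f i <= b) -> a <= \sum_(i in A) w i * f i <= b.
Proof.
move=> w0 w1 fab; rewrite -[X in X <= _]mulr1 -[X in _ && (_ <= X)]mulr1 -w1 !mulr_sumr.
apply/andP; split; apply: ler_sum => i iA; have /andP[fa fb] := fab i iA.
  by rewrite mulrC ler_wpM2l ?w0.
by rewrite [leRHS]mulrC ler_wpM2l ?w0.
Qed.

Lemma ler_norm_wsum (I : finType) (A : pred I) (w f : I -> R) m :
  (forall i, i \in A -> 0 <= w i) -> \sum_(i in A) w i = 1 ->
  (forall i, i \in A -> `|f i| <= m) -> `|\sum_(i in A) w i * f i| <= m.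
Proof.
move=> w0 w1 fm; rewrite ler_norml wsum_between// => i iA.
by rewrite -ler_norml fm.
Qed.

End averages.

(** * Weighted geometric means, the form of the second layer *)

Section geometric_mean.
Context {R : realType} (I : finType) (A : pred I) (w : I -> R) (c : R).
Hypothesis w0 : forall i, i \in A -> 0 <= w i.
Hypothesis w1 : \sum_(i in A) w i = 1.
Let L := expR c.
Let gm (v : I -> R) := expR (\sum_(i in A) w i * ln (v i)).
Let ok (v : I -> R) := forall i, 1 <= v i <= L.

Let ln_between v : ok v -> forall i, i \in A -> 0 <= ln (v i) <= c.
Proof.
move=> vL i _; have /andP[v1 v2] := vL i; rewrite ln_ge0//=.
by rewrite -[c]expRK ler_ln ?posrE ?expR_gt0//; lra.
Qed.

Let sum_between v : ok v -> 0 <= \sum_(i in A) w i * ln (v i) <= c.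
Proof. by move=> /ln_between vL; exact: wsum_between. Qed.

Lemma gm_between v : ok v -> 1 <= gm v <= L.
Proof. by move=> /sum_between/andP[? ?]; rewrite -expR0 /gm /L !ler_expR; apply/andP. Qed.

Let dist_sum u v m : ok u -> ok v -> (forall i, i \in A -> `|u i - v i| <= m) ->
  `|\sum_(i in A) w i * ln (u i) - \sum_(i in A) w i * ln (v i)| <= m.
Proof.
move=> uL vL uv; rewrite -sumrB.
under eq_bigr do rewrite -mulrBr.
apply: ler_norm_wsum => // i iA; rewrite (le_trans _ (uv i iA))// ler_dist_ln//.
  by have /andP[] := uL i.
by have /andP[] := vL i.
Qed.

Lemma gm_dist u v m : ok u -> ok v -> (forall i, i \in A -> `|u i - v i| <= m) ->
  `|gm u - gm v| <= L * m.
Proof.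
move=> uL vL uv; have /andP[_ u2] := sum_between uL; have /andP[_ v2] := sum_between vL.
by rewrite (le_trans (ler_dist_expR u2 v2))// ler_wpM2l ?expR_ge0// dist_sum.
Qed.

Lemma gm_dist2 u' u v' v m t r : ok u' -> ok u -> ok v' -> ok v ->
  (forall i, i \in A -> `|u i - v i| <= m) -> (forall i, i \in A -> `|u' i - u i| <= t) ->
  (forall i, i \in A -> `|v' i - v i| <= t) ->
  (forall i, i \in A -> `|(u' i - u i) - (v' i - v i)| <= r) ->
  `|(gm u' - gm u) - (gm v' - gm v)| <= L ^+ 2 * (L * r + 2 * m * t).
Proof.
move=> u'L uL v'L vL uv uu vv dd.
have := ler_dist2_expR (sum_between u'L) (sum_between uL) (sum_between v'L) (sum_between vL).
move=> /le_trans; apply; rewrite ler_wpM2l ?sqr_ge0//.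
have H1 := dist_sum uL vL uv; have H2 := dist_sum u'L uL uu.
(* One cross term [m * t] comes from the second difference of [expR], the other from that of
   [ln]. *)
have -> : L * r + 2 * m * t = m * t + (L * r + m * t) by ring.
rewrite lerD ?ler_pM//.
rewrite -!sumrB; under eq_bigr do rewrite -!mulrBr.
apply: ler_norm_wsum => // i iA.
have /andP[u'1 _] := u'L i; have /andP[u1 _] := uL i.
have /andP[v'1 _] := v'L i; have /andP[v1 v2] := vL i.
rewrite (le_trans (ler_dist2_ln u'1 u1 v'1 v1 v2))// lerD ?ler_pM ?ler_wpM2l ?expR_ge0 ?uv ?vv
  ?dd//.
Qed.

End geometric_mean.

(** * Nets and cells close to a level *)

Section nets.
Context {R : realType} {d : nat}.
Implicit Types (a b v th : 'rV[R]_d) (Th : set 'rV[R]_d).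

Definition coord_near (e : R) a b : Prop := forall j, `|a ord0 j - b ord0 j| <= e.

Lemma coord_nearC e a b : coord_near e a b -> coord_near e b a.
Proof. by move=> H j; rewrite distrC. Qed.

Lemma coord_near_trans e e' a b c : coord_near e a b -> coord_near e' b c ->
  coord_near (e + e') a c.
Proof.
move=> ab bc j; rewrite (le_trans (ler_distD (b ord0 j) _ _))// lerD//; exact: ab || exact: bc.
Qed.

Lemma coord_near_enorm a b : coord_near (enorm (a - b)) a b.
Proof.
move=> j; rewrite -[leLHS]sqrtr_sqr ler_wsqrtr// (bigD1 j)//= !mxE lerDl.
by apply: sumr_ge0 => i _; rewrite sqr_ge0.
Qed.

(** [d.+1] is a crude substitute for the square root of [d]; it is positive in every dimension and
    can be divided by. *)
Lemma enorm_coord_near e a b : 0 <= e -> coord_near e a b -> enorm (a - b) <= d.+1%:R * e.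
Proof.
move=> e0 ab; have de0 : 0 <= d.+1%:R * e by rewrite mulr_ge0.
rewrite -[leRHS]ger0_norm// -[leRHS]sqrtr_sqr ler_wsqrtr//.
apply: (@le_trans _ _ (\sum_(i < d) e ^+ 2)).
  apply: ler_sum => i _; rewrite !mxE -[leLHS]real_normK ?num_real//.
  by rewrite lerXn2r ?nnegrE//; exact: ab.
rewrite sumr_const card_ord -[leLHS]mulr_natl exprMn ler_wpM2r ?sqr_ge0//.
by rewrite -natrX ler_nat (leq_trans (leqnSn d))// leq_pmull.
Qed.

(** [Th] lies in the cube of half-side [D] around [a0]. Cutting the cube into cells of side [e] and
    choosing one point of [Th] per cell keeps the net inside [Th], where the Lipschitz bounds
    hold. *)
Lemma finite_net Th (D e : R) : Th !=set0 -> 0 <= D -> 0 < e ->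
  (forall a b, Th a -> Th b -> enorm (a - b) <= D) ->
  exists (I : finType) (c : I -> 'rV[R]_d), [/\ forall i, Th (c i),
    forall th, Th th -> exists i, coord_near e th (c i), (0 < #|I|)%N &
    #|I|%:R <= (2 * D / e + 1) ^+ d].
Proof.
move=> [a0 Ta0] D0 e0 TD; pose n := Num.truncn (2 * D / e).
pose x (th : 'rV[R]_d) j := (th ord0 j - a0 ord0 j + D) / e.
pose cell (th : 'rV[R]_d) : {ffun 'I_d -> 'I_n.+1} := [ffun j => inord (Num.truncn (x th j))].
have xb th j : Th th -> 0 <= x th j <= 2 * D / e.
  move=> Tth; have := coord_near_enorm th a0 j.
  move=> /le_trans/(_ (TD _ _ Tth Ta0)); rewrite ler_norml => /andP[h1 h2].
  rewrite divr_ge0 ?(ltW e0)//=; last by rewrite -lerBlDr sub0r.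
  by rewrite ler_pM2r ?invr_gt0//; lra.
have cellE th j : Th th -> val (cell th j) = Num.truncn (x th j).
  move=> Tth; have /andP[_ h2] := xb th j Tth; rewrite ffunE /= inordK// ltnS.
  exact: le_truncn.
exists {ffun 'I_d -> 'I_n.+1}.
(* Cells that miss [Th] are represented by [a0], so that every net point is in [Th]. *)
exists (fun i => xget a0 [set th | Th th /\ cell th = i]); split.
- move=> i; case: xgetP => [th _ [Tth _]//|_]; exact: Ta0.
- move=> th Tth; exists (cell th); case: xgetP => [th' _ [Tth' cc] j|/(_ th)]; last first.
    by move=> H; exfalso; exact: H.
  have : Num.truncn (x th j) = Num.truncn (x th' j) by rewrite -!cellE// cc.
  have /andP[u1 _] := xb th j Tth; have /andP[u2 _] := xb th' j Tth'.
  have /andP[] := truncn_itv u1; have /andP[] := truncn_itv u2.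
  move=> p1 p2 p3 p4 E; move: p3 p4; rewrite E => p3 p4.
  have H : `|x th j - x th' j| <= 1.
    by move: p2 p4; rewrite -natr1 ler_norml => *; apply/andP; split; lra.
  have -> : th ord0 j - th' ord0 j = (x th j - x th' j) * e.
    by rewrite /x; field; rewrite gt_eqF.
  by rewrite normrM [`|e|]gtr0_norm// -[leRHS]mul1r ler_wpM2r// ltW.
- by rewrite card_ffun !card_ord expn_gt0.
- rewrite card_ffun !card_ord natrX lerXn2r ?nnegrE// ?addr_ge0 ?divr_ge0 ?mulr_ge0 ?(ltW e0)//.
  rewrite -natr1 lerD2r; have : 0 <= 2 * D / e by rewrite divr_ge0 ?mulr_ge0 ?(ltW e0).
  by move=> /truncn_itv/andP[].
Qed.

(* A cell of the net either stays away from the level v by a fixed gap, or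
   contains points with values arbitrarily close to v. *)
Lemma near_level_set Th (G : 'rV[R]_d -> R) (D v e : R) : Th !=set0 -> 0 <= D -> 0 < e ->
  (forall a b, Th a -> Th b -> enorm (a - b) <= D) ->
  exists2 g, 0 < g & forall th, Th th -> G th < v + g ->
    forall eta, 0 < eta -> exists th', [/\ Th th', coord_near e th th' & G th' <= v + eta].
Proof.
move=> T0 D0 e0 TD; have e20 : 0 < e / 2 by rewrite divr_gt0.
have [I [c [_ cov _ _]]] := finite_net T0 D0 e20 TD.
pose cellP i th := Th th /\ coord_near (e / 2) th (c i).
have /choice[g gP] : forall i, exists g : R, 0 < g /\
    ((forall th, cellP i th -> v + g <= G th) \/
     (forall eta, 0 < eta -> exists2 th, cellP i th & G th <= v + eta)).
  move=> i.
  have [[g g0 gH]|H] := pselect (exists2 g, 0 < g & forall th, cellP i th -> v + g <= G th).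
    by exists g; split => //; left.
  exists 1; split => //; right => eta eta0; apply: contrapT => nH; apply: H.
  exists eta => // th Cth; rewrite leNgt; apply/negP => lt; apply: nH.
  by exists th => //; exact: ltW.
(* A minimum over finitely many cells remains positive, whatever the shape of the level sets of
   [G]. *)
exists (\big[Num.min/1]_i g i).
  by apply: lt_bigmin => // i _; have [] := gP i.
move=> th Tth Gth eta eta0; have [i ti] := cov th Tth.
have [gi0 [H|H]] := gP i.
  have := H th (conj Tth ti); rewrite leNgt (lt_le_trans Gth)// lerD2l.
  exact: bigmin_le_cond.
have [th' [Tth' ti'] Gth'] := H eta eta0; exists th'; split => //.
by rewrite [e]splitr; apply: coord_near_trans ti _; exact: coord_nearC.
Qed.

End nets.

(** * Deviations of the empirical objective *)

Section model.
Context {R : realType} {dx dy dth : nat} {S : finType}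
  (z : S -> 'rV[R]_dx * 'rV[R]_dy) (pw : S -> R) {Z : Type}
  (Psi : Z -> 'rV[R]_dy -> R) (f : 'rV[R]_dth -> 'rV[R]_dx -> Z) (lam eps : R)
  (Q : probability (@Borel R dx) R) (W : probability (@Borel R dy) R)
  (Th : set 'rV[R]_dth) (Lth B : R).
Hypothesis pw0 : forall s, 0 < pw s.
Hypothesis pw1 : \sum_s pw s = 1.
Hypothesis lam0 : 0 < lam.
Hypothesis eps0 : 0 < eps.
Hypothesis mPsi : Psi_measurable Psi f.
Hypothesis Psi_lip : forall x y th th', Th th -> Th th' ->
  `|Psi (f th x) y - Psi (f th' x) y| <= Lth * enorm (th - th').
Hypothesis Psi_bd : forall zz y, 0 <= Psi zz y <= B.

Let M := lam * eps.
Let beta := B / M.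
Let L := expR beta.
(** [Lth] comes without a sign, hence the absolute value. The summand 1 makes the constant positive:
    it will divide the radius of comparison. *)
Definition t3_lip : R := L * (`|Lth| / M) + 1.
Let ell := t3_lip.

Local Notation t3 := (t3 z Psi f lam eps).
Local Notation t2 := (t2 z pw).
Local Notation phi2 := (phi2 z Psi f lam eps W).
Local Notation phi1 := (phi1 z pw Psi f lam eps Q W).
Local Notation cls := (cls z).

Let M0 : 0 < M. Proof. exact: mulr_gt0. Qed.

Lemma t3_lip_gt0 : 0 < t3_lip.
Proof. by rewrite /t3_lip ltr_wpDl// !mulr_ge0 ?expR_ge0 ?invr_ge0// ltW. Qed.

Lemma beta_ge0 : 0 <= beta.
Proof.
have /andP[h0 hB] := Psi_bd (f 0 0) 0.
by rewrite divr_ge0 ?(ltW M0)//; exact: le_trans hB.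
Qed.

Lemma L_ge1 : 1 <= L. Proof. by rewrite -expR0 ler_expR beta_ge0. Qed.

(** The lower bound 1, due to [Psi >= 0], is inherited by all averages and geometric means and keeps
    every logarithm where [ln] is 1-Lipschitz. *)
Lemma t3_between th x xi1 xi2 s : 1 <= t3 th x xi1 xi2 s <= L.
Proof.
have /andP[h0 hB] := Psi_bd (f th (x + xi1)) ((z s).2 + xi2).
rewrite /t3 -[X in X <= _]expR0 !ler_expR divr_ge0 ?(ltW M0)//=.
by rewrite ler_pM2r ?invr_gt0.
Qed.

Lemma t3_dist th th' x xi1 xi2 s : Th th -> Th th' ->
  `|t3 th x xi1 xi2 s - t3 th' x xi1 xi2 s| <= ell * enorm (th - th').
Proof.
move=> Tth Tth'; have e0 : 0 <= enorm (th - th') by exact: sqrtr_ge0.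
have H a : Psi (f a (x + xi1)) ((z s).2 + xi2) / M <= beta.
  by rewrite ler_pM2r ?invr_gt0//; have /andP[] := Psi_bd (f a (x + xi1)) ((z s).2 + xi2).
rewrite (le_trans (ler_dist_expR (H th) (H th')))//.
rewrite -mulrBl normrM [`|M^-1|]ger0_norm ?invr_ge0 ?(ltW M0)//.
rewrite /ell /t3_lip mulrDl mul1r (@le_trans _ _ (L * (`|Lth| / M) * enorm (th - th')))//.
  rewrite -!mulrA ler_wpM2l ?expR_ge0// mulrC [leRHS]mulrC -mulrA.
  rewrite ler_wpM2l ?invr_ge0 ?(ltW M0)// (le_trans (Psi_lip _ _ Tth Tth'))//.
  by rewrite [leRHS]mulrC ler_wpM2r// ler_norm.
by rewrite lerDl.
Qed.

Lemma measurable_t3 th x s : measurable_fun setT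
  (fun q : @Borel R dx * @Borel R dy => t3 th x q.1 q.2 s).
Proof.
rewrite /Defs.t3; apply: (measurableT_comp (@measurable_expR R)).
by apply: measurable_funM; [exact: mPsi|exact: measurable_cst].
Qed.

Lemma measurable_t3r th x xi1 s :
  measurable_fun setT (fun xi2 : @Borel R dy => t3 th x xi1 xi2 s).
Proof.
pose h (q : @Borel R dx * @Borel R dy) := t3 th x q.1 q.2 s.
have mh : measurable_fun setT h by exact: measurable_t3.
exact: (measurableT_comp mh (@pair1_measurable _ _ (@Borel R dx) (@Borel R dy) xi1)).
Qed.

Let t3_norm th x xi1 xi2 s : `|t3 th x xi1 xi2 s| <= L.
Proof. by have /andP[h1 hL] := t3_between th x xi1 xi2 s; rewrite ger0_norm//; lra. Qed.

Lemma phi2_between th s xi1 s' : 1 <= phi2 th s xi1 s' <= L.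
Proof.
exact: (Rintegral_between W (@measurable_t3r th (z s).1 xi1 s')
  (fun y => t3_between th (z s).1 xi1 y s')).
Qed.

Lemma Rintegral_dist d (T : measurableType d) (V : probability T R) (g g' : T -> R) b m :
  measurable_fun setT g -> measurable_fun setT g' ->
  (forall y, `|g y| <= b) -> (forall y, `|g' y| <= b) ->
  (forall y, `|g y - g' y| <= m) ->
  `|(\int[V]_y g y)%R - (\int[V]_y g' y)%R| <= m.
Proof.
move=> mg mg' gb g'b gg.
rewrite -RintegralB//; try exact: (bounded_integrable V _ gb);
  try exact: (bounded_integrable V _ g'b).
rewrite ler_norml; apply: Rintegral_between; first exact: measurable_funB.
by move=> y; rewrite -ler_norml.
Qed.

Lemma phi2_dist th th' s xi1 s' : Th th -> Th th' ->
  `|phi2 th s xi1 s' - phi2 th' s xi1 s'| <= ell * enorm (th - th').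
Proof.
move=> Tth Tth'; apply: (Rintegral_dist W (measurable_t3r _ _ _ _) (measurable_t3r _ _ _ _)).
- by move=> y; exact: t3_norm.
- by move=> y; exact: t3_norm.
- by move=> y; exact: t3_dist.
Qed.

Lemma measurable_phi2 th s s' :
  measurable_fun setT (fun xi1 : @Borel R dx => phi2 th s xi1 s').
Proof.
apply/measurable_EFinP.
rewrite (_ : EFin \o _ = fubini_F W (fun q : @Borel R dx * @Borel R dy => (t3 th (z s).1 q.1
  q.2 s')%:E)).
  apply: measurable_fun_fubini_tonelli_F.
    by apply/measurable_EFinP; exact: measurable_t3.
  by move=> q; rewrite lee_fin; have /andP[h1 _] := t3_between th (z s).1 q.1 q.2 s'; lra.
apply/funext => xi1; rewrite /fubini_F/=; apply/esym.
exact: (@EFin_Rintegral _ _ _ W _ L (@measurable_t3r th (z s).1 xi1 s')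
  (fun y => t3_norm th (z s).1 xi1 y s')).
Qed.

Lemma pcond_ge0 s s' : s' \in cls s -> 0 <= pcond z pw s s'.
Proof. by move=> _; rewrite divr_ge0 ?(ltW (pw0 _))// sumr_ge0// => i _; exact: ltW. Qed.

Lemma pcond_sum s : \sum_(s' in cls s) pcond z pw s s' = 1.
Proof.
rewrite -mulr_suml divff// gt_eqF// (bigD1 s)/=; last by rewrite inE/= eqxx.
by rewrite ltr_wpDr// sumr_ge0// => i _; exact: ltW.
Qed.

Lemma t2_between s v : (forall s', 1 <= v s' <= L) -> 1 <= t2 s v <= L.
Proof. exact: (gm_between (@pcond_ge0 s) (pcond_sum s)). Qed.

Lemma t2_dist s u v m : (forall s', 1 <= u s' <= L) -> (forall s', 1 <= v s' <= L) ->
  (forall s', s' \in cls s -> `|u s' - v s'| <= m) -> `|t2 s u - t2 s v| <= L * m.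
Proof. exact: (gm_dist (@pcond_ge0 s) (pcond_sum s)). Qed.

Definition gfun th s (xi1 : 'rV[R]_dx) : R := t2 s (phi2 th s xi1).

Lemma gfun_between th s xi1 : 1 <= gfun th s xi1 <= L.
Proof. by apply: t2_between => s'; exact: phi2_between. Qed.

Lemma gfun_dist th th' s xi1 : Th th -> Th th' ->
  `|gfun th s xi1 - gfun th' s xi1| <= L * (ell * enorm (th - th')).
Proof.
move=> Tth Tth'; apply: t2_dist; try by move=> s'; exact: phi2_between.
by move=> s' _; exact: phi2_dist.
Qed.

Lemma measurable_gfun th s : measurable_fun setT (gfun th s : @Borel R dx -> R).
Proof.
rewrite /gfun /Defs.t2; apply: (measurableT_comp (@measurable_expR R)).
under eq_fun do rewrite big_mkcond.
apply: measurable_sum => s'; case: (s' \in cls s) => //=.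
apply: measurable_funM => //.
by apply: (measurableT_comp (@measurable_ln R)); exact: measurable_phi2.
Qed.

Let gfun_norm th s xi1 : `|gfun th s xi1| <= L.
Proof. by have /andP[h1 hL] := gfun_between th s xi1; rewrite ger0_norm//; lra. Qed.

Lemma phi1_between th s : 1 <= phi1 th s <= L.
Proof. exact: (Rintegral_between Q (@measurable_gfun th s) (gfun_between th s)). Qed.

Lemma phi1_dist th th' s : Th th -> Th th' ->
  `|phi1 th s - phi1 th' s| <= L * (ell * enorm (th - th')).
Proof.
move=> Tth Tth'.
apply: (Rintegral_dist Q (measurable_gfun _ _) (measurable_gfun _ _) (gfun_norm _ _) (gfun_norm
  _ _)).
by move=> y; exact: gfun_dist.
Qed.

Local Notation F := (Fobj z pw Psi f lam eps Q W).

Lemma Fobj_dist th th' : Th th -> Th th' ->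
  `|F th - F th'| <= M * (L * (ell * enorm (th - th'))).
Proof.
move=> Tth Tth'; rewrite /Fobj -mulrBr normrM [`|_ * eps|]ger0_norm ?(ltW M0)//.
rewrite ler_wpM2l ?(ltW M0)// -sumrB.
under eq_bigr do rewrite -mulrBr.
apply: ler_norm_wsum => [s _||s _]; [exact: ltW|by []|].
have /andP[h1 _] := phi1_between th s; have /andP[h2 _] := phi1_between th' s.
by rewrite (le_trans (ler_dist_ln h1 h2))// phi1_dist.
Qed.

Definition h3 th s s' (q : @Borel R dx * @Borel R dy) : R :=
  t3 th (z s).1 q.1 q.2 s' - phi2 th s q.1 s'.
Definition h2 th s (q : unit * @Borel R dx) : R := gfun th s q.2 - phi1 th s.
Definition h1 s (q : unit * bool) : R := q.2%:R - pw s.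

(** * Deterministic analysis of the empirical objective for given samples *)

Section sample.
Variables (N1 N2 N3 : nat) (sx : 'I_N1 -> S) (a1 : 'I_N2 -> 'rV[R]_dx)
  (a2 : 'I_N3 -> 'rV[R]_dy).
Hypothesis N1_gt0 : (0 < N1)%N.
Hypothesis N2_gt0 : (0 < N2)%N.
Hypothesis N3_gt0 : (0 < N3)%N.

Let uh th s xi1 s' := N3%:R^-1 * \sum_(k < N3) t3 th (z s).1 xi1 (a2 k) s'.
Let vh th s := N2%:R^-1 * \sum_(j < N2) t2 s (uh th s (a1 j)).
Let Fh th := Fhat z pw Psi f lam eps sx a1 a2 th.

Definition dev3 th s j s' : R := N3%:R^-1 * \sum_k h3 th s s' (a1 j, a2 k).
Definition dev2 th s : R := N2%:R^-1 * \sum_j h2 th s (tt, a1 j).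
Definition dev1 s : R := N1%:R^-1 * \sum_i h1 s (tt, sx i == s).

Let uh_between th s xi1 s' : 1 <= uh th s xi1 s' <= L.
Proof. by apply: mean_between => // k; exact: t3_between. Qed.

Let vh_between th s : 1 <= vh th s <= L.
Proof. by apply: mean_between => // j; apply: t2_between => s'; exact: uh_between. Qed.

Let uh_dist th th' s xi1 s' : Th th -> Th th' ->
  `|uh th s xi1 s' - uh th' s xi1 s'| <= ell * enorm (th - th').
Proof.
move=> Tth Tth'; rewrite /uh -mulrBr -sumrB; apply: ler_norm_mean => // k.
exact: t3_dist.
Qed.

Let vh_dist th th' s : Th th -> Th th' ->
  `|vh th s - vh th' s| <= L * (ell * enorm (th - th')).
Proof.
move=> Tth Tth'; rewrite /vh -mulrBr -sumrB; apply: ler_norm_mean => // j.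
by apply: t2_dist => s'; [exact: uh_between|exact: uh_between|move=> _; exact: uh_dist].
Qed.

Let FhE th : Fh th = M * (N1%:R^-1 * \sum_i ln (vh th (sx i))).
Proof. by rewrite /Fh /Fhat -mulrA. Qed.

Lemma Fhat_dist th th' : Th th -> Th th' ->
  `|Fh th - Fh th'| <= M * (L * (ell * enorm (th - th'))).
Proof.
move=> Tth Tth'; rewrite !FhE -mulrBr normrM [`|M|]ger0_norm ?(ltW M0)//.
rewrite ler_wpM2l ?(ltW M0)// -mulrBr -sumrB; apply: ler_norm_mean => // i.
have /andP[g1 _] := vh_between th (sx i); have /andP[g2 _] := vh_between th' (sx i).
by rewrite (le_trans (ler_dist_ln g1 g2))// vh_dist.
Qed.

Let uhB th s j s' : uh th s (a1 j) s' - phi2 th s (a1 j) s' = dev3 th s j s'.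
Proof.
rewrite /uh /dev3 /h3/= sumrB mulrBr; congr (_ - _).
by rewrite sumr_const card_ord -[X in _ * X]mulr_natl mulKf// pnatr_eq0 -lt0n.
Qed.

Let vhB th s : vh th s - phi1 th s =
  N2%:R^-1 * (\sum_j (t2 s (uh th s (a1 j)) - gfun th s (a1 j))) + dev2 th s.
Proof.
have {1}-> : phi1 th s = N2%:R^-1 * \sum_(j < N2) phi1 th s.
  by rewrite sumr_const card_ord -[X in _ * X]mulr_natl mulKf// pnatr_eq0 -lt0n.
rewrite /vh /dev2 -mulrBr -mulrDr -sumrB -big_split/=; congr (_ * _).
by apply: eq_bigr => j _; rewrite /h2/=; ring.
Qed.

Let ph s : R := N1%:R^-1 * \sum_i (sx i == s)%:R.

Let phB s : ph s - pw s = dev1 s.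
Proof.
rewrite /ph /dev1 /h1/= sumrB mulrBr; congr (_ - _).
by rewrite sumr_const card_ord -[X in _ * X]mulr_natl mulKf// pnatr_eq0 -lt0n.
Qed.

Let ph_sum g : N1%:R^-1 * \sum_i g (sx i) = \sum_s ph s * g s.
Proof.
rewrite /ph; under [RHS]eq_bigr do rewrite -mulrA mulr_suml.
rewrite -mulr_sumr exchange_big/=; congr (_ * _); apply: eq_bigr => i _.
rewrite (bigD1 (sx i))//= eqxx mul1r big1 ?addr0// => s si.
by rewrite eq_sym (negbTE si) mul0r.
Qed.

Let ph_ge0 s : 0 <= ph s.
Proof. by rewrite mulr_ge0 ?invr_ge0// sumr_ge0. Qed.

Let ph1 : \sum_s ph s = 1.
Proof.
have := ph_sum (fun=> 1); under [X in _ = X]eq_bigr do rewrite mulr1.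
by move=> <-; rewrite sumr_const card_ord mulVf// pnatr_eq0 -lt0n.
Qed.

(** Grouping the outer samples by atom separates the inner error, weighted by the empirical
    frequencies [ph], from the frequency error tested against the true [ln (phi1 th s)]. *)
Let FhB th : Fh th - F th = M * (\sum_s ph s * (ln (vh th s) - ln (phi1 th s)) +
  \sum_s (ph s - pw s) * ln (phi1 th s)).
Proof.
rewrite FhE (ph_sum (fun s => ln (vh th s))) /Fobj -mulrBr; congr (_ * _).
rewrite -sumrB -big_split/=; apply: eq_bigr => s _; rewrite /Defs.t1; ring.
Qed.

Variables (t r : R).
Hypothesis t0 : 0 <= t.
Hypothesis phi1_or_dev1 :
  (forall th, Th th -> forall s s', phi1 th s = phi1 th s') \/ (forall s, `|dev1 s| <= t).

(* Only [s'] in the class of [s]: the other coordinates of the averages enter neither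
   [t2] nor [sigma3sq]. *)
Definition dev_le th := (forall s j s', s' \in cls s -> `|dev3 th s j s'| <= t) /\
  (forall s, `|dev2 th s| <= t).
Definition dev_dist_le th th' :=
  (forall s j s', s' \in cls s -> `|dev3 th s j s' - dev3 th' s j s'| <= r) /\
  (forall s, `|dev2 th s - dev2 th' s| <= r).

Let vh_dev th s : dev_le th -> `|vh th s - phi1 th s| <= (L + 1) * t.
Proof.
move=> [d3 d2]; rewrite vhB mulrDl mul1r (le_trans (ler_normD _ _))// lerD//.
apply: ler_norm_mean => // j; apply: t2_dist => s'; [exact: uh_between|exact: phi2_between|].
by move=> s'A; rewrite uhB; exact: d3.
Qed.

(** A function constant over the atoms is annihilated, since [ph] and [pw] both have total mass 1.
    This handles a vanishing [sigma1sq]: then [phi1] is constant over the atoms although the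
    frequencies may still fluctuate. *)
Let sum_ph_pw (g : S -> R) m : (forall s, `|g s| <= m) ->
  ((forall s s', g s = g s') \/ (forall s, `|dev1 s| <= t)) ->
  `|\sum_s (ph s - pw s) * g s| <= #|S|%:R * (t * m).
Proof.
have m0 s : `|g s| <= m -> 0 <= m by exact: le_trans.
move=> gm [gc|d1].
  have [s _|S0] := pickP {: S}; last first.
    by move: pw1; rewrite big_pred0// => /eqP; rewrite eq_sym oner_eq0.
  rewrite (eq_bigr (fun i => (ph i - pw i) * g s)); last by move=> i _; rewrite (gc i s).
  rewrite -mulr_suml sumrB ph1 pw1 subrr mul0r normr0.
  by rewrite !mulr_ge0// (m0 s).
rewrite (le_trans (ler_norm_sum _ _ _))//.
rewrite (_ : #|S|%:R * _ = \sum_(s : S) t * m); last by rewrite sumr_const mulr_natl.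
by apply: ler_sum => s _; rewrite normrM phB ler_pM.
Qed.

Lemma Fhat_dev th : Th th -> dev_le th ->
  `|Fh th - F th| <= M * ((L + 1) * t + #|S|%:R * (t * beta)).
Proof.
move=> Tth dvth; rewrite FhB normrM [`|M|]ger0_norm ?(ltW M0)// ler_wpM2l ?(ltW M0)//.
rewrite (le_trans (ler_normD _ _))// lerD//.
  apply: ler_norm_wsum => // s _.
  have /andP[g1 _] := vh_between th s; have /andP[g2 _] := phi1_between th s.
  by rewrite (le_trans (ler_dist_ln g1 g2))// vh_dev.
apply: sum_ph_pw => [s|].
  have /andP[g1 g2] := phi1_between th s; rewrite ger0_norm ?ln_ge0//.
  by rewrite -[beta]expRK ler_ln ?posrE ?expR_gt0//; lra.
case: phi1_or_dev1 => [H|]; [left => s s'; by rewrite (H th Tth s s')|by right].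
Qed.

Let sum_diff2 (k e a b c d : S -> R) :
  (\sum_s k s * a s + \sum_s e s * b s) - (\sum_s k s * c s + \sum_s e s * d s) =
  \sum_s k s * (a s - c s) + \sum_s e s * (b s - d s).
Proof. by rewrite opprD addrACA -!sumrB; congr (_ + _); apply: eq_bigr => s _; ring. Qed.

Let mean_diff2 (n a b : R) (g h : 'I_N2 -> R) :
  (n * (\sum_j g j) + a) - (n * (\sum_j h j) + b) = n * \sum_j (g j - h j) + (a - b).
Proof. by rewrite sumrB; ring. Qed.

(** Every term contains [r] or the product [m * t], never [t] alone, so [t] may be a large multiple
    of [delta] once [m] is small. Products [m * t] come from the cross terms of the second
    differences and from the frequency error against an increment of [ln phi1]. *)
Lemma Fhat_dev_dist th th' m : Th th -> Th th' -> dev_le th -> dev_le th' ->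
  dev_dist_le th th' -> ell * enorm (th - th') <= m ->
  `|(Fh th - F th) - (Fh th' - F th')| <=
  M * (L * (L ^+ 2 * (L * r + 2 * m * t) + r) + (L * m) * ((L + 1) * t) +
       #|S|%:R * (t * (L * m))).
Proof.
move=> Tth Tth' dvth dvth' [dd3 dd2] dm; have -> : (Fh th - F th) - (Fh th' - F th') = _ :=
  congr2 (fun a b => a - b) (FhB th) (FhB th').
rewrite -[X in `|X|]mulrBr normrM [`|M|](ger0_norm (ltW M0)).
apply: ler_wpM2l; first exact: ltW.
have L0 : 0 <= L by exact: expR_ge0.
rewrite [X in `|X|](_ : _ = \sum_s ph s * ((ln (vh th s) - ln (phi1 th s)) -
    (ln (vh th' s) - ln (phi1 th' s))) +
  \sum_s (ph s - pw s) * (ln (phi1 th s) - ln (phi1 th' s))); last first.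
  exact: sum_diff2.
apply: (le_trans (ler_normD _ _)); apply: lerD.
  apply: ler_norm_wsum => // s _.
  have /andP[g1 _] := vh_between th s; have /andP[g2 _] := phi1_between th s.
  have /andP[g3 _] := vh_between th' s; have /andP[g4 g5] := phi1_between th' s.
  apply: (le_trans (ler_dist2_ln g1 g2 g3 g4 g5)); apply: lerD; last first.
    apply: ler_pM => //; last exact: vh_dev.
    by apply: (le_trans (phi1_dist _ Tth Tth')); apply: ler_wpM2l.
  apply: ler_wpM2l => //.
  have -> : (vh th s - phi1 th s) - (vh th' s - phi1 th' s) = _ :=
    congr2 (fun a b => a - b) (vhB th s) (vhB th' s).
  rewrite mean_diff2; apply: (le_trans (ler_normD _ _)); apply: lerD => //.
  apply: ler_norm_mean => // j.
  apply: (gm_dist2 (@pcond_ge0 s) (pcond_sum s) (uh_between th s (a1 j))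
    (phi2_between th s (a1 j)) (uh_between th' s (a1 j)) (phi2_between th' s (a1 j))) => s' s'A.
  - by rewrite (le_trans (phi2_dist _ _ _ Tth Tth')).
  - by rewrite uhB; exact: dvth.1 s'A.
  - by rewrite uhB; exact: dvth'.1 s'A.
  - by rewrite !uhB; exact: dd3.
apply: sum_ph_pw => [s|].
  have /andP[g2 _] := phi1_between th s; have /andP[g4 g5] := phi1_between th' s.
  rewrite (le_trans (ler_dist_ln g2 g4))// (le_trans (phi1_dist _ Tth Tth'))//.
  by rewrite ler_wpM2l.
case: phi1_or_dev1 => [H|]; last by right.
by left => s s'; rewrite (H th Tth s s') (H th' Tth' s s').
Qed.

End sample.

(** The bound [b] matters: an unbounded set has [sup] equal to 0 by convention, and a zero sigma
    would then say nothing. *)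
Lemma sup_eq0_mem (A : set R) b x : (forall y, A y -> y <= b) -> sup A = 0 -> A x -> x <= 0.
Proof.
by move=> Ab <- Ax; apply: ub_le_sup => //; exists b => y /Ab.
Qed.

(** * Size, centring and vanishing of the summands *)

Let sqr_norm (c y : R) : `|y| <= c -> 0 <= y ^+ 2 <= c ^+ 2.
Proof.
move=> yc; rewrite sqr_ge0/= -[y ^+ 2]real_normK ?num_real//.
by rewrite lerXn2r ?nnegrE// (le_trans _ yc).
Qed.

Lemma measurable_h3 th s s' : measurable_fun setT (h3 th s s').
Proof.
apply: measurable_funB; first exact: measurable_t3.
have mphi : measurable_fun setT (fun xi1 : @Borel R dx => phi2 th s xi1 s').
  exact: measurable_phi2.
exact: (measurableT_comp mphi measurable_fst).
Qed.

Let between_norm (a b : R) : 1 <= a <= L -> 1 <= b <= L -> `|a - b| <= L.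
Proof. by move=> /andP[? ?] /andP[? ?]; rewrite ler_norml; apply/andP; split; lra. Qed.

Lemma h3_norm th s s' q : `|h3 th s s' q| <= L.
Proof. by apply: between_norm; [exact: t3_between|exact: phi2_between]. Qed.

Lemma h3_dist th th' s s' q : Th th -> Th th' ->
  `|h3 th s s' q - h3 th' s s' q| <= 2 * (ell * enorm (th - th')).
Proof.
move=> Tth Tth'; rewrite /h3 opprD addrACA -opprD.
rewrite [2 * _]mulr_natl mulr2n (le_trans (ler_normB _ _))// lerD//.
  exact: t3_dist.
exact: phi2_dist.
Qed.

Lemma h3_centered th s s' (x : @Borel R dx) : (\int[W]_y h3 th s s' (x, y))%R = 0.
Proof.
have mt := @measurable_t3r th (z s).1 x s'.
have ti := bounded_integrable W mt (fun y => t3_norm th (z s).1 x y s').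
rewrite /h3/= RintegralB//; last first.
  by apply: (@bounded_integrable _ _ _ W _ `|phi2 th s x s'|).
by rewrite Rintegral_prob_cst subrr.
Qed.

Let int_h3_between th s s' (x : @Borel R dx) :
  0 <= (\int[W]_y (h3 th s s' (x, y)) ^+ 2)%R <= L ^+ 2.
Proof.
apply: Rintegral_between => [|y]; last exact/sqr_norm/h3_norm.
apply: measurable_funX.
exact: (measurableT_comp (measurable_h3 th s s') (pair1_measurable x)).
Qed.

(** [sigma3sq] is a supremum of sums of nonnegative variances over [cls s]; when it is 0, each
    variance in the class vanishes. *)
Lemma h3_null th s s' (x : @Borel R dx) : sigma3sq z Psi f lam eps W Th = 0 -> Th th ->
  s' \in cls s -> (\int[W]_y (h3 th s s' (x, y)) ^+ 2)%R = 0.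
Proof.
move=> s30 Tth ss'.
have H : \sum_(s1 in cls s) (\int[W]_y (h3 th s s1 (x, y)) ^+ 2)%R <= 0.
  apply: (@sup_eq0_mem _ (#|S|%:R * L ^+ 2) _ _ s30); last first.
    by exists th => //; exists (s, x).
  move=> _ [th' _ [[s1 x1] _ <-]].
  apply: (@le_trans _ _ (\sum_(s2 in cls s1) L ^+ 2)).
    by apply: ler_sum => s2 _; have /andP[] := int_h3_between th' s1 s2 x1.
  by rewrite sumr_const -[L ^+ 2 *+ _]mulr_natl ler_wpM2r ?sqr_ge0// ler_nat max_card.
have i0 s1 := andP (int_h3_between th s s1 x).
apply/eqP; rewrite eq_le; apply/andP; split; last by case: (i0 s').
apply: le_trans H; rewrite (bigD1 s' ss') lerDl; apply: sumr_ge0 => s1 _.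
by case: (i0 s1).
Qed.

Lemma measurable_h2 th s : measurable_fun setT (h2 th s).
Proof.
apply: measurable_funB => //.
exact: (measurableT_comp (measurable_gfun th s) measurable_snd).
Qed.

Lemma h2_norm th s q : `|h2 th s q| <= L.
Proof. by apply: between_norm; [exact: gfun_between|exact: phi1_between]. Qed.

Lemma h2_dist th th' s q : Th th -> Th th' ->
  `|h2 th s q - h2 th' s q| <= 2 * (L * (ell * enorm (th - th'))).
Proof.
move=> Tth Tth'; rewrite /h2 opprD addrACA -opprD.
rewrite [2 * _]mulr_natl mulr2n (le_trans (ler_normB _ _))// lerD//.
  exact: gfun_dist.
exact: phi1_dist.
Qed.

Lemma h2_centered th s u : (\int[Q]_y h2 th s (u, y))%R = 0.
Proof.
have gi := bounded_integrable Q (measurable_gfun th s) (gfun_norm th s).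
rewrite /h2/= RintegralB//; last by apply: (@bounded_integrable _ _ _ Q _ `|phi1 th s|).
by rewrite Rintegral_prob_cst subrr.
Qed.

Let int_h2_between th s u : 0 <= (\int[Q]_y (h2 th s (u, y)) ^+ 2)%R <= L ^+ 2.
Proof.
apply: Rintegral_between => [|y]; last exact/sqr_norm/h2_norm.
apply: measurable_funX.
exact: (measurableT_comp (measurable_h2 th s) (pair1_measurable u)).
Qed.

Lemma h2_null th s u : sigma2sq z pw Psi f lam eps Q W Th = 0 -> Th th ->
  (\int[Q]_y (h2 th s (u, y)) ^+ 2)%R = 0.
Proof.
move=> s20 Tth; apply/eqP; rewrite eq_le; apply/andP; split;
  last by case/andP: (int_h2_between th s u).
apply: (@sup_eq0_mem _ (L ^+ 2) _ _ s20); last first.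
  by exists th => //; exists s.
by move=> _ [th' _ [s' _ <-]]; have /andP[_] := int_h2_between th' s' u.
Qed.

Lemma measurable_h1 s : measurable_fun setT (h1 s).
Proof.
apply: measurable_funB => //.
have mb : measurable_fun setT (fun b : bool => b%:R : R) by [].
exact: (measurableT_comp mb measurable_snd).
Qed.

Lemma pw_le1 s : pw s <= 1.
Proof. by rewrite -pw1 (bigD1 s)//= lerDl sumr_ge0// => s' _; exact: ltW. Qed.

Lemma h1_norm s q : `|h1 s q| <= 1.
Proof.
have := pw_le1 s; have := pw0 s; case: q => u b; rewrite /h1/= ler_norml.
by case: b => /= *; apply/andP; split; lra.
Qed.

Lemma h1_centered s u : (\int[bernoulli_prob (pw s)]_y h1 s (u, y))%R = 0.
Proof.
have mb : measurable_fun setT (fun b : bool => b%:R : R) by [].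
have bi : (bernoulli_prob (pw s)).-integrable setT (EFin \o (fun b : bool => b%:R)).
  by apply: (@bounded_integrable _ _ _ (bernoulli_prob (pw s)) _ 1) => // -[];
    rewrite ?normr1 ?normr0.
rewrite /h1/= RintegralB//; last first.
  by apply: (@bounded_integrable _ _ _ (bernoulli_prob (pw s)) _ `|pw s|).
rewrite Rintegral_prob_cst /Rintegral integral_bernoulli_prob//; last first.
  by rewrite ltW//= pw_le1.
by rewrite mule1 mule0 adde0 /= subrr.
Qed.

(** All weights being positive, a zero variance makes [ln (phi1 th s)] equal to its mean at every
    atom, and [ln] is injective on positive numbers. *)
Lemma phi1_const : sigma1sq z pw Psi f lam eps Q W Th = 0 ->
  forall th, Th th -> forall s s', phi1 th s = phi1 th s'.
Proof.
move=> s10 th Tth.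
pose m := \sum_(s0 : S) pw s0 * ln (phi1 th s0).
pose V th' := \sum_s pw s * (ln (phi1 th' s) - \sum_(s0 : S) pw s0 * ln (phi1 th' s0)) ^+ 2.
have lnb th' s : 0 <= ln (phi1 th' s) <= beta.
  have /andP[g1 g2] := phi1_between th' s; rewrite ln_ge0//=.
  by rewrite -[beta]expRK ler_ln ?posrE ?expR_gt0//; lra.
have V0 : V th <= 0.
  apply: (@sup_eq0_mem _ (beta ^+ 2) _ _ s10); last by exists th.
  move=> _ [th' _ <-].
  have mb : 0 <= \sum_(s0 : S) pw s0 * ln (phi1 th' s0) <= beta.
    by apply: wsum_between => // s _; exact: ltW.
  have H s : s \in predT -> 0 <= (ln (phi1 th' s) -
      \sum_(s0 : S) pw s0 * ln (phi1 th' s0)) ^+ 2 <= beta ^+ 2.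
    move=> _; apply: sqr_norm; have /andP[? ?] := lnb th' s; have /andP[? ?] := mb.
    by rewrite ler_norml; apply/andP; split; lra.
  by have /andP[_] := wsum_between (fun s _ => ltW (pw0 s)) pw1 H.
have lnm s : ln (phi1 th s) = m.
  have t0 s' : 0 <= pw s' * (ln (phi1 th s') - m) ^+ 2 by rewrite mulr_ge0 ?sqr_ge0// ltW.
  have : pw s * (ln (phi1 th s) - m) ^+ 2 <= 0.
    by rewrite (le_trans _ V0)// /V (bigD1 s)//= lerDl sumr_ge0.
  rewrite le_eqVlt ltNge t0 orbF mulf_eq0 gt_eqF//= sqrf_eq0 subr_eq0.
  by move/eqP.
move=> s s'; have := lnm s; rewrite -(lnm s') => /ln_inj; apply.
  by have /andP[] := phi1_between th s; rewrite posrE; lra.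
by have /andP[] := phi1_between th s'; rewrite posrE; lra.
Qed.

(** * The exceptional event over pairs of net points *)

Section bad_event.
Context {d0 : measure_display} {Om : measurableType d0} (P : probability Om R)
  {N1 N2 N3 : nat} (sx : 'I_N1 -> Om -> S) (x1 : 'I_N2 -> Om -> 'rV[R]_dx)
  (x2 : 'I_N3 -> Om -> 'rV[R]_dy).
Hypothesis N1_gt0 : (0 < N1)%N.
Hypothesis N2_gt0 : (0 < N2)%N.
Hypothesis N3_gt0 : (0 < N3)%N.
Hypothesis iid : iid_samples pw Q W P sx x1 x2.
Variables (I : finType) (c : I -> 'rV[R]_dth) (rho t r k : R).
Hypothesis Thc : forall i, Th (c i).
Hypothesis rho0 : 0 < rho.
Hypothesis t0 : 0 < t.
Hypothesis r0 : 0 < r.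
Hypothesis t4 : t <= 4.
Hypothesis r8 : r <= 8 * (L * (ell * rho)).
Hypothesis kt : k <= t ^+ 2 / (32 * L ^+ 2).
Hypothesis kr : k <= r ^+ 2 / (32 * (2 * (L * (ell * rho))) ^+ 2).

Let s1 := sigma1sq z pw Psi f lam eps Q W Th.
Let s2 := sigma2sq z pw Psi f lam eps Q W Th.
Let s3 := sigma3sq z Psi f lam eps W Th.
(** The indicator [(s != 0)%:R] records that a layer with zero sigma costs no probability. The
    factor 4 counts two controls, each two-sided. *)
Let e (s : R) (N : nat) : R := 4 * ((s != 0)%:R * expR (- (N%:R * k))).

(* The fallback [c i] makes every pair [(c i, near_pt i i')] close. *)
Let near_pt i i' := if enorm (c i - c i') <= rho then c i' else c i.

Let Th_near i i' : Th (near_pt i i').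
Proof. by rewrite /near_pt; case: ifP. Qed.

Let near_ptP i i' : enorm (c i - near_pt i i') <= rho.
Proof.
rewrite /near_pt; case: ifPn => // _.
by rewrite subrr /enorm big1 ?sqrtr0 ?(ltW rho0)// => j _; rewrite mxE expr0n.
Qed.

Let L0 : 0 < L. Proof. exact: expR_gt0. Qed.
Let Ler0 : 0 < 2 * (L * (ell * rho)).
Proof. by rewrite !mulr_gt0// t3_lip_gt0. Qed.

Let h3_near i i' s s' q :
  `|h3 (c i) s s' q - h3 (near_pt i i') s s' q| <= 2 * (L * (ell * rho)).
Proof.
rewrite (le_trans (h3_dist _ _ _ (Thc i) (Th_near i i')))//.
rewrite ler_wpM2l// -[leLHS]mul1r ler_pM ?L_ge1 ?mulr_ge0 ?sqrtr_ge0 ?(ltW t3_lip_gt0)//.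
by rewrite ler_wpM2l ?(ltW t3_lip_gt0)// near_ptP.
Qed.

Let h2_near i i' s q :
  `|h2 (c i) s q - h2 (near_pt i i') s q| <= 2 * (L * (ell * rho)).
Proof.
rewrite (le_trans (h2_dist _ _ (Thc i) (Th_near i i')))//.
by rewrite !ler_wpM2l ?(ltW L0) ?(ltW t3_lip_gt0)// near_ptP.
Qed.

Let tL : t <= 4 * L.
Proof. by rewrite (le_trans t4)// ler_peMr// L_ge1. Qed.

Let r8' : r <= 4 * (2 * (L * (ell * rho))).
Proof. by rewrite mulrA (_ : 4 * 2 = 8)//; ring. Qed.

Let X1 j : Om -> @Borel R dx := x1 j.
Let X2 k : Om -> @Borel R dy := x2 k.

Let layer3 : exists A : set Om, [/\ measurable A,
  (forall om, ~ A om -> forall i i' s j s', s' \in cls s ->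
    ~ pair_dev (X1 j) X2 (h3 (c i) s s') (h3 (near_pt i i') s s') t r om) &
  (P A <= (#|{: I * I * (S * ('I_N2 * S))}|%:R * e s3 N3)%:E)%E].
Proof.
(* Outside the class the event is taken empty: [h3_null] does not apply there and [dev_le] asks for
   nothing. *)
pose E (p : I * I * (S * ('I_N2 * S))) :=
  if p.2.2.2 \in cls p.2.1 then
    pair_dev (X1 p.2.2.1) X2 (h3 (c p.1.1) p.2.1 p.2.2.2)
      (h3 (near_pt p.1.1 p.1.2) p.2.1 p.2.2.2) t r
  else set0.
have [||A [mA AE PA]] := @fin_union_bound _ _ _ P _ E (e s3 N3).
- move=> p; rewrite /E; case: ifP => // _; apply: measurable_pair_dev;
    [exact: (iid_measurable1 iid)|exact: (iid_measurable2 iid)|exact: measurable_h3..].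
- move=> [[i i'] [s [j s']]]; rewrite /E/=; case: ifPn => ss'; last first.
    by rewrite measure0 lee_fin !mulr_ge0// expR_ge0.
  rewrite /e; have [s30|_] := eqVneq s3 0; last first.
    rewrite mul1r; apply: (pair_dev_centered (iid_measurable1 iid j)
      (iid_measurable2 iid) (iid_indep2 pw1 iid j) N3_gt0 (measurable_h3 _ _ _)
      (measurable_h3 _ _ _) L0 Ler0 (h3_norm _ _ _) (h3_norm _ _ _) (h3_near i i' s s')
      t0 r0 tL r8' kt kr); by move=> x; exact: h3_centered.
  rewrite mul0r mulr0 (pair_dev_null (iid_measurable1 iid j)
    (iid_measurable2 iid) (iid_indep2 pw1 iid j) N3_gt0 (measurable_h3 _ _ _)
    (measurable_h3 _ _ _) (h3_norm _ _ _) (h3_norm _ _ _) (h3_near i i' s s') t0 r0)//.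
  + by move=> x; apply: h3_null.
  + by move=> x; apply: h3_null.
exists A; split => // om nA i i' s j s' ss' H; apply: nA.
by apply: (AE (i, i', (s, (j, s')))); rewrite /E/= ss'.
Qed.

Let layer2 : exists A : set Om, [/\ measurable A,
  (forall om, ~ A om -> forall i i' s,
    ~ pair_dev (fun=> tt) X1 (h2 (c i) s) (h2 (near_pt i i') s) t r om) &
  (P A <= (#|{: I * I * S}|%:R * e s2 N2)%:E)%E].
Proof.
pose E (p : I * I * S) := pair_dev (fun _ : Om => tt) X1 (h2 (c p.1.1) p.2)
  (h2 (near_pt p.1.1 p.1.2) p.2) t r.
have [||A [mA AE PA]] := @fin_union_bound _ _ _ P _ E (e s2 N2).
- move=> p; apply: measurable_pair_dev;
    [by []|exact: (iid_measurable1 iid)|exact: measurable_h2..].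
- move=> [[i i'] s]; rewrite /E/=.
  rewrite /e; have [s20|_] := eqVneq s2 0; last first.
    rewrite mul1r; apply: (pair_dev_centered (measurable_cst _)
      (iid_measurable1 iid) (iid_indep1 pw1 iid) N2_gt0 (measurable_h2 _ _)
      (measurable_h2 _ _) L0 Ler0 (h2_norm _ _) (h2_norm _ _) (h2_near i i' s)
      t0 r0 tL r8' kt kr); by move=> x; exact: h2_centered.
  rewrite mul0r mulr0 (pair_dev_null (measurable_cst _)
    (iid_measurable1 iid) (iid_indep1 pw1 iid) N2_gt0 (measurable_h2 _ _)
    (measurable_h2 _ _) (h2_norm _ _) (h2_norm _ _) (h2_near i i' s) t0 r0)//.
  + by move=> x; apply: h2_null.
  + by move=> x; apply: h2_null.
exists A; split => // om nA i i' s H; apply: nA.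
exact: (AE (i, i', s)).
Qed.

Let layer1 : exists A : set Om, [/\ measurable A,
  (forall om, ~ A om ->
    (forall th, Th th -> forall s s', phi1 th s = phi1 th s') \/
    (forall s, ~ mean_dev (fun=> tt) (fun i om => sx i om == s) (h1 s) t om)) &
  (P A <= (#|S|%:R * e s1 N1)%:E)%E].
Proof.
have [s10|s1n0] := eqVneq s1 0.
  exists set0; split => //.
    by move=> om _; left; exact: phi1_const.
  by rewrite measure0 lee_fin /e s10 eqxx mul0r !mulr0.
pose E s := mean_dev (fun _ : Om => tt) (fun i om => sx i om == s) (h1 s) t.
have [||A [mA AE PA]] := @fin_union_bound _ _ _ P _ E (e s1 N1).
- move=> s; apply: measurable_mean_dev; [by []| |exact: measurable_h1].
  by move=> i; exact: (iid_measurable0 iid).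
- move=> s; rewrite /E.
  have := mean_dev_centered (measurable_cst tt) (fun i => iid_measurable0 iid i s)
    (iid_indep0 pw0 pw1 iid s) N1_gt0 (measurable_h1 s) ltr01 (h1_norm s) t0.
  rewrite mulr1 => /(_ t4 (h1_centered s)) /le_trans; apply.
  (* The frequencies do not depend on the parameter, so there is no increment to control. The factor
     2 is relaxed to 4 and the range 1 to [L], to share the form of the other layers. *)
  rewrite lee_fin /e s1n0 mul1r ler_pM ?expR_ge0//; first by rewrite ler_nat.
  rewrite ler_expR lerN2 -mulrA ler_wpM2l// (le_trans kt)//.
  rewrite ler_wpM2l ?sqr_ge0// lef_pV2 ?posrE ?mulr_gt0 ?exprn_gt0//.
  by rewrite ler_wpM2l// lerXn2r ?nnegrE ?(ltW L0)// L_ge1.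
exists A; split => // om nA; right => s H; apply: nA; exact: (AE s).
Qed.

Lemma bad_event : (0 < #|I|)%N -> exists A : set Om, [/\ measurable A,
  (P A <= (4 * #|I|%:R ^+ 2 * #|S|%:R ^+ 2 *
    ((s1 != 0)%:R * expR (- (N1%:R * k)) + (s2 != 0)%:R * expR (- (N2%:R * k)) +
     N2%:R * ((s3 != 0)%:R * expR (- (N3%:R * k)))))%:E)%E &
  forall om, ~ A om ->
    [/\ (forall th, Th th -> forall s s', phi1 th s = phi1 th s') \/
        (forall s, `|dev1 (sx ^~ om) s| <= t),
      (forall i, dev_le (x1 ^~ om) (x2 ^~ om) t (c i)) &
      (forall i i', enorm (c i - c i') <= rho ->
         dev_dist_le (x1 ^~ om) (x2 ^~ om) r (c i) (c i'))]].
Proof.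
move=> I0; have [A3 [mA3 A3P PA3]] := layer3; have [A2 [mA2 A2P PA2]] := layer2.
have [A1 [mA1 A1P PA1]] := layer1.
have ltP (a b : R) : ~ a <= b -> b <= a by move/negP; rewrite -ltNge => /ltW.
exists (A1 `|` (A2 `|` A3)); split.
- by apply: measurableU => //; exact: measurableU.
- apply: (le_trans (measureU2 P mA1 (measurableU _ _ mA2 mA3))).
  apply: (@le_trans _ _ ((#|S|%:R * e s1 N1)%:E +
    ((#|{: I * I * S}|%:R * e s2 N2)%:E + (#|{: I * I * (S * ('I_N2 * S))}|%:R * e s3 N3)%:E))%E).
    apply: leeD => //; apply: (le_trans (measureU2 P mA2 mA3)); exact: leeD.
  rewrite -!EFinD lee_fin !card_prod card_ord !natrM /e.
  have S0 : (0 < #|S|)%N.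
    rewrite lt0n; apply/negP => /eqP/card0_eq S0; move: pw1.
    by rewrite big_pred0// => /eqP; rewrite eq_sym oner_eq0.
  have i1 : 1 <= #|I|%:R :> R by rewrite ler1n.
  have S1 : 1 <= #|S|%:R :> R by rewrite ler1n.
  set a1 := (s1 != 0)%:R * _; set a2 := (s2 != 0)%:R * _; set a3 := (s3 != 0)%:R * _.
  have a10 : 0 <= a1 by rewrite mulr_ge0 ?expR_ge0.
  have a20 : 0 <= a2 by rewrite mulr_ge0 ?expR_ge0.
  have -> : 4 * #|I|%:R ^+ 2 * #|S|%:R ^+ 2 * (a1 + a2 + N2%:R * a3) =
    4 * (#|I|%:R ^+ 2 * #|S|%:R ^+ 2) * a1 + (4 * (#|I|%:R ^+ 2 * #|S|%:R ^+ 2) * a2 +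
    #|I|%:R * #|I|%:R * (#|S|%:R * (N2%:R * #|S|%:R)) * (4 * a3)) :> R by ring.
  have II : 1 <= #|I|%:R ^+ 2 :> R by rewrite exprn_ege1.
  have SS : #|S|%:R <= #|S|%:R ^+ 2 :> R by rewrite expr2 ler_peMr.
  apply: lerD.
    rewrite mulrA [_ * 4]mulrC ler_wpM2r// ler_wpM2l//.
    by rewrite -[leLHS]mul1r ler_pM.
  rewrite lerD2r mulrA [_ * 4]mulrC ler_wpM2r// ler_wpM2l//.
  by rewrite -expr2 ler_wpM2l// sqr_ge0.
move=> om nA; have {}A1P := A1P om (fun H => nA (or_introl H)).
have {}A2P := A2P om (fun H => nA (or_intror (or_introl H))).
have {}A3P := A3P om (fun H => nA (or_intror (or_intror H))).
split.
- case: A1P => [|H]; [by left|right => s]; apply: ltP; exact: H.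
- move=> i; split => [s j s' ss'|s]; apply: ltP => H.
    by apply: (A3P i i s j s' ss'); left.
  by apply: (A2P i i s); left.
- move=> i i' ii'; have np : near_pt i i' = c i' by rewrite /near_pt ii'.
  split => [s j s' ss'|s]; apply: ltP => H.
    apply: (A3P i i' s j s' ss'); right; rewrite np /mean_dev/=.
    by move: H; rewrite /dev3 -mulrBr -sumrB.
  apply: (A2P i i' s); right; rewrite np /mean_dev/=.
  by move: H; rewrite /dev2 -mulrBr -sumrB.
Qed.

End bad_event.

(** * Contradiction between a gap and controlled deviations *)

Section gap.
Variables (D : R) (thstar : 'rV[R]_dth).
Hypothesis D0 : 0 <= D.
Hypothesis ThD : forall a b, Th a -> Th b -> enorm (a - b) <= D.
Hypothesis Th_star : Th thstar.

Let s1 := sigma1sq z pw Psi f lam eps Q W Th.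
Let s2 := sigma2sq z pw Psi f lam eps Q W Th.
Let s3 := sigma3sq z Psi f lam eps W Th.

Let opt_step (x y w d : R) : `|x - y| <= d -> x <= w -> y <= w + d.
Proof. by rewrite ler_norml => /andP[? ?] ?; lra. Qed.

Let gap_step (x y v d : R) : `|x - y| <= d / 16 -> d < x - v -> v + 15 / 16 * d < y.
Proof. by rewrite ler_norml => /andP[? ?] ?; lra. Qed.

Let near_step (x x' w v y y' d q : R) : `|w - x'| <= d / 16 -> w <= v + d / 16 ->
  v + 15 / 16 * d < x -> y <= y' + d / 16 -> q <= 1 / 8 -> 0 < d ->
  ~ `|(y - x) - (y' - x')| <= d / 8 + q * d.
Proof.
rewrite !ler_norml => /andP[? ?] ? ? ? q8 d0 /andP[? ?].
have : q * d <= 1 / 8 * d by rewrite ler_wpM2r// ltW.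
by lra.
Qed.

Let far_step (x x' v y y' d q g : R) : `|v - x'| <= d / 16 -> v + g <= x ->
  y <= y' + d / 16 -> d * (2 * q + 1) < g -> 0 < d -> `|y - x| <= q * d ->
  ~ `|y' - x'| <= q * d.
Proof.
by rewrite !ler_norml => /andP[? ?] ? ? ? d0 /andP[? ?] /andP[? ?]; lra.
Qed.

(** The order of choices matters: [m], [rho] and the gap [g0] depend on [K] and on the problem
    alone, so [delta1] can be fixed after them and before the sample sizes. *)
Lemma gap_tail (K : R) : 0 < K -> exists C0 delta1 : R, [/\ 0 < C0, 0 < delta1 &
  forall delta : R, 0 < delta < delta1 ->
  forall (N1 N2 N3 : nat), (0 < N1)%N -> (0 < N2)%N -> (0 < N3)%N ->
  forall (d0 : measure_display) (Om : measurableType d0) (P : probability Om R)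
    (sx : 'I_N1 -> Om -> S) (x1 : 'I_N2 -> Om -> 'rV[R]_dx)
    (x2 : 'I_N3 -> Om -> 'rV[R]_dy) (thhat : Om -> 'rV[R]_dth),
  iid_samples pw Q W P sx x1 x2 ->
  (forall om, Th (thhat om) /\ forall th, Th th ->
    Fhat z pw Psi f lam eps (sx ^~ om) (x1 ^~ om) (x2 ^~ om) (thhat om) <=
    Fhat z pw Psi f lam eps (sx ^~ om) (x1 ^~ om) (x2 ^~ om) th) ->
  exists A : set Om, [/\ measurable A,
    [set om | F (thhat om) - F thstar > delta] `<=` A &
    (P A <= (C0 * delta^-1 ^+ (2 * dth) *
      ((s1 != 0)%:R * expR (- (N1%:R * (K * delta ^+ 2))) +
       (s2 != 0)%:R * expR (- (N2%:R * (K * delta ^+ 2))) +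
       N2%:R * ((s3 != 0)%:R * expR (- (N3%:R * (K * delta ^+ 2))))))%:E)%E]].
Proof.
move=> K0; pose d1 : R := dth.+1%:R.
have d10 : 0 < d1 by rewrite ltr0n.
have L1 := L_ge1; have L0 : 0 < L by exact: expR_gt0.
have ell0 : 0 < ell by exact: t3_lip_gt0.
have b0 := beta_ge0.
have n0 : 0 <= #|S|%:R :> R by [].
pose n : R := #|S|%:R.
pose LF := M * (L * ell); have LF0 : 0 < LF by rewrite !mulr_gt0.
(* With [t = Kp * delta], the rate [t ^+ 2 / (32 * L ^+ 2)] equals [2 * (K + 1) ^+ 2 * delta ^+ 2],
   above [K * delta ^+ 2]. *)
pose Kp := 8 * L * (K + 1); have Kp0 : 0 < Kp by rewrite !mulr_gt0// addr_gt0.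
have L30 : 0 < L ^+ 3 + 1 by rewrite addr_gt0// exprn_gt0.
(* With [r = c0 * delta], the terms of [Fhat_dev_dist] in [r] add up to exactly [delta / 8]. *)
pose c0 := (8 * M * L * (L ^+ 3 + 1))^-1.
have c00 : 0 < c0 by rewrite invr_gt0 !mulr_gt0.
pose Cq := 2 * L ^+ 3 + L * (L + 1) + n * L.
have Cq0 : 0 < Cq.
  by rewrite ltr_wpDr ?mulr_ge0 ?(ltW L0)// ltr_wpDr ?mulr_ge0 ?addr_ge0 ?(ltW L0)// mulr_gt0//
    exprn_gt0.
(* The first bound keeps the terms in [m * t] below [delta / 8]. The second gives increments, of
   size at most [2 * (L * m)], the rate [K] at scale [r]; the 12 is there because [12 ^+ 2] exceeds
   [32 * 2 ^+ 2]. *)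
pose m := Num.min (8 * M * Kp * Cq)^-1 (c0 / (12 * L * (K + 1))).
have B1 : 0 < 8 * M * Kp * Cq by exact: (mulr_gt0 (mulr_gt0 (mulr_gt0 _ M0) Kp0) Cq0).
have B2 : 0 < 12 * L * (K + 1) by rewrite !mulr_gt0// addr_gt0.
have m0 : 0 < m by rewrite lt_min invr_gt0 B1/= divr_gt0.
have m1 : M * m * Kp * Cq <= 1 / 8.
  have : m <= (8 * M * Kp * Cq)^-1 by rewrite ge_min lexx.
  rewrite -[X in _ <= X]mul1r ler_pdivlMr//; lra.
have m2 : m * (12 * L * (K + 1)) <= c0.
  rewrite -ler_pdivlMr//.
  by rewrite ge_min lexx orbT.
pose rho := m / ell; have rho0 : 0 < rho by rewrite divr_gt0.
have rhoE : ell * rho = m by rewrite /rho mulrC divfK// gt_eqF.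
(* Two coordinatewise moves of size at most [a], to a near-minimal point and then to the net, stay
   within Euclidean distance [rho]. *)
pose a := rho / (2 * d1); have a0 : 0 < a by rewrite divr_gt0// mulr_gt0.
pose Q1 := M * Kp * (L + 1 + n * beta).
have Q10 : 0 <= Q1.
  apply: mulr_ge0; first exact: (mulr_ge0 (ltW M0) (ltW Kp0)).
  by apply: addr_ge0; [apply: addr_ge0 => //; exact: ltW|exact: mulr_ge0].
have T0 : Th !=set0 by exists thstar.
have [g0 g00 loc] := near_level_set F (F thstar) T0 D0 a0 ThD.
pose G := 32 * D * LF * d1 + 1.
have G0 : 0 < G by rewrite ltr_wpDl// !mulr_ge0// ltW.
have S0 : (0 < #|S|)%N.
  rewrite lt0n; apply/negP => /eqP/card0_eq S0; move: pw1.
  by rewrite big_pred0// => /eqP; rewrite eq_sym oner_eq0.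
exists (4 * G ^+ (2 * dth) * n ^+ 2).
(* In order, these ensure [delta <= 1], [t <= 4], [r <= 8 * L * m], [e <= a], and that [g0]
   dominates first-order deviations. *)
exists (Num.min 1 (Num.min (4 / Kp) (Num.min (8 * L * m / c0)
  (Num.min (16 * LF * d1 * a) (g0 / (2 * Q1 + 1)))))); split.
- by rewrite !mulr_gt0 ?exprn_gt0// ltr0n.
- have p1 : 0 < 4 / Kp by exact: divr_gt0.
  have p2 : 0 < 8 * L * m / c0 by apply: divr_gt0 => //; rewrite mulr_gt0// mulr_gt0.
  have p3 : 0 < 16 * LF * d1 * a by rewrite mulr_gt0// mulr_gt0// mulr_gt0.
  have p4 : 0 < g0 / (2 * Q1 + 1) by apply: divr_gt0 => //; rewrite ltr_wpDl// mulr_ge0.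
  by rewrite !lt_min ltr01 p1 p2 p3 p4.
move=> delta /andP[dl0]; rewrite !lt_min => /and5P[dl1 dlK dlm dla dlg].
move=> N1 N2 N3 N10 N20 N30 d0 Om P sx x1 x2 thhat iid opt.
pose e := delta / (16 * LF * d1).
have LFd : 0 < 16 * LF * d1 by rewrite mulr_gt0// mulr_gt0.
have e0 : 0 < e by rewrite divr_gt0.
have ea : e <= a by rewrite ler_pdivrMr// mulrC ltW.
have [I [c [Tc cov I0 cardI]]] := finite_net T0 D0 e0 ThD.
pose t := Kp * delta; pose r := c0 * delta.
have t0 : 0 < t by rewrite mulr_gt0.
have r0 : 0 < r by rewrite mulr_gt0.
have t4 : t <= 4 by move: dlK; rewrite ltr_pdivlMr// mulrC => /ltW.
have r8 : r <= 8 * (L * (ell * rho)).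
  by rewrite rhoE mulrA; move: dlm; rewrite ltr_pdivlMr// mulrC => /ltW.
have KK : K <= (K + 1) ^+ 2 by nra.
have kt : K * delta ^+ 2 <= t ^+ 2 / (32 * L ^+ 2).
  have -> : t ^+ 2 / (32 * L ^+ 2) = 2 * (K + 1) ^+ 2 * delta ^+ 2.
    by rewrite /t /Kp; field; rewrite gt_eqF.
  by rewrite ler_wpM2r ?sqr_ge0//; nra.
have kr : K * delta ^+ 2 <= r ^+ 2 / (32 * (2 * (L * (ell * rho))) ^+ 2).
  rewrite rhoE ler_pdivlMr ?mulr_gt0 ?exprn_gt0 ?mulr_gt0//.
  have H : (m * (12 * L * (K + 1))) ^+ 2 <= c0 ^+ 2.
    by rewrite lerXn2r ?nnegrE ?(ltW c00)// !mulr_ge0 ?(ltW m0) ?(ltW L0)// addr_ge0// ltW.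
  have -> : r ^+ 2 = c0 ^+ 2 * delta ^+ 2 by rewrite /r exprMn.
  apply: (@le_trans _ _ ((m * (12 * L * (K + 1))) ^+ 2 * delta ^+ 2)); last first.
    by rewrite ler_wpM2r ?sqr_ge0.
  have -> : K * delta ^+ 2 * (32 * (2 * (L * m)) ^+ 2) = 128 * K * (L * m) ^+ 2 * delta ^+ 2.
    by ring.
  have -> : (m * (12 * L * (K + 1))) ^+ 2 * delta ^+ 2 =
    144 * (K + 1) ^+ 2 * (L * m) ^+ 2 * delta ^+ 2 by ring.
  by rewrite !ler_wpM2r ?sqr_ge0//; nra.
have [A [mA PA AP]] := bad_event N10 N20 N30 iid Tc rho0 t0 r0 t4 r8 kt kr I0.
exists A; split => //; last first.
  apply: (le_trans PA); rewrite lee_fin; apply: ler_wpM2r.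
    have pe (b : bool) x : 0 <= b%:R * expR x by rewrite mulr_ge0// expR_ge0.
    by apply: addr_ge0; [exact: addr_ge0|exact: mulr_ge0].
  have -> : 4 * G ^+ (2 * dth) * n ^+ 2 * delta^-1 ^+ (2 * dth) =
      4 * ((G / delta) ^+ dth) ^+ 2 * n ^+ 2.
    by rewrite -exprM mulnC expr_div_n exprVn; ring.
  rewrite ler_wpM2r ?sqr_ge0// ler_wpM2l// lerXn2r ?nnegrE//.
    by apply: exprn_ge0; apply: divr_ge0; exact: ltW.
  apply: (le_trans cardI); have De0 : 0 <= 2 * D / e.
    by apply: divr_ge0; [exact: mulr_ge0|exact: ltW].
  have Gd0 : 0 <= G / delta by apply: divr_ge0; exact: ltW.
  apply: lerXn2r; rewrite ?nnegrE//; first exact: addr_ge0.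
  have -> : 2 * D / e = 32 * D * LF * d1 / delta.
    by rewrite /e; field; rewrite !gt_eqF.
  rewrite /G [X in _ <= X]mulrDl lerD2l mul1r.
  by rewrite -[leLHS]invr1 lef_pV2 ?posrE// ltW.
move=> om /= gap; apply: contrapT => /AP[phi_dev dev dist].
have [Thh hopt] := opt om; set th := thhat om in Thh hopt gap.
set Fh := Fhat z pw Psi f lam eps _ _ _ in hopt.
have Fnear b b' : Th b -> Th b' -> coord_near e b b' ->
    `|F b - F b'| <= delta / 16 /\ `|Fh b - Fh b'| <= delta / 16.
  move=> Tb Tb' bb; have := enorm_coord_near (ltW e0) bb => En.
  have H : M * (L * (ell * enorm (b - b'))) <= delta / 16.
    have -> : M * (L * (ell * enorm (b - b'))) = LF * enorm (b - b') by rewrite /LF; ring.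
    have -> : delta / 16 = LF * (d1 * e) by rewrite /e; field; rewrite !gt_eqF.
    by rewrite ler_wpM2l// ltW.
  split; apply: le_trans H; first exact: Fobj_dist.
  exact: Fhat_dist.
have [i thi] := cov th Thh.
have [Fi Fhi] := Fnear th (c i) Thh (Tc i) thi.
have Fhi_opt b : Th b -> Fh (c i) <= Fh b + delta / 16.
  by move=> /hopt; exact: opt_step.
have Fi_gap : F thstar + 15 / 16 * delta < F (c i).
  exact: (gap_step Fi gap).
(* Near the minimum, a gap forces a second difference larger than [3 / 4 * delta] in absolute value,
   against an allowed [delta / 4]. Farther away, [g0] exceeds the first-order deviations at [c i]
   and at the net point next to [thstar]. *)
have [near_min|far] := ltP (F (c i)) (F thstar + g0).
  have d16 : 0 < delta / 16 by rewrite divr_gt0.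
  have [th' [Tth' nth' Fth']] := loc (c i) (Tc i) near_min _ d16.
  have [i' thi'] := cov th' Tth'.
  have [Fi' _] := Fnear th' (c i') Tth' (Tc i') thi'.
  have cc : enorm (c i - c i') <= rho.
    have ae : 0 <= a + e by rewrite addr_ge0 ?ltW.
    rewrite (le_trans (enorm_coord_near ae (coord_near_trans nth' thi')))//.
    have -> : rho = d1 * (a + a) by rewrite /a; field; rewrite gt_eqF.
    by rewrite ler_wpM2l ?lerD2l.
  have mE : ell * enorm (c i - c i') <= m by rewrite -rhoE ler_wpM2l// ltW.
  apply: (near_step Fi' Fth' Fi_gap (Fhi_opt _ (Tc i')) m1 dl0).
  apply: le_trans (Fhat_dev_dist N10 N20 N30 (ltW t0) phi_dev (Tc i) (Tc i')
    (dev i) (dev i') (dist i i' cc) mE) _.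
  rewrite le_eqVlt; apply/orP; left; apply/eqP.
  by rewrite -/n /r /t /Cq /c0; field; rewrite !gt_eqF.
have [i' thi'] := cov thstar Th_star.
have [Fi' _] := Fnear thstar (c i') Th_star (Tc i') thi'.
have dg : delta * (2 * Q1 + 1) < g0 by rewrite -ltr_pdivlMr// ltr_wpDl// mulr_ge0.
have QE : M * ((L + 1) * t + n * (t * beta)) = Q1 * delta by rewrite /t /Q1; ring.
apply: (far_step Fi' far (Fhi_opt _ (Tc i')) dg dl0); rewrite -QE.
  exact: (Fhat_dev N10 N20 N30 (ltW t0) phi_dev (Tc i) (dev i)).
exact: (Fhat_dev N10 N20 N30 (ltW t0) phi_dev (Tc i') (dev i')).
Qed.

End gap.

End model.

(** * From the gap bound to the theorem *)

Section absorption.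
Context {R : realType}.
Variables (C0 c delta : R) (d : nat).
Hypothesis C00 : 0 < C0.
Hypothesis c0 : 0 < c.
Hypothesis dl0 : 0 < delta.
Hypothesis dl1 : delta <= 1.
Hypothesis d0 : (0 < d)%N.
Hypothesis small : 3 * C0 * delta <= c ^+ (3 * d).

Let g := (delta / c) ^+ d.
Let g0 : 0 < g. Proof. by rewrite exprn_gt0// divr_gt0. Qed.
Let covE : (c / delta) ^+ d = g^-1. Proof. by rewrite /g -exprVn invf_div. Qed.

(** Of the [3 * d] powers of [delta] in [g ^+ 3], [2 * d] cancel the squared net. The remaining
    [delta ^+ d] is at most [delta] because [0 < d], and [small] finishes. The factor 3 leaves room
    for three layers. *)
Lemma net_absorb : C0 * delta^-1 ^+ (2 * d) * g ^+ 3 * 3 <= 1.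
Proof.
have -> : g ^+ 3 = delta ^+ (2 * d) * delta ^+ d / c ^+ (3 * d).
  by rewrite /g -exprM [(d * 3)%N]mulnC expr_div_n -exprD -mulSnr.
have -> : C0 * delta^-1 ^+ (2 * d) * (delta ^+ (2 * d) * delta ^+ d / c ^+ (3 * d)) * 3 =
    3 * C0 * delta ^+ d / c ^+ (3 * d).
  by rewrite exprVn; field; rewrite !expf_eq0 !gt_eqF// !andbF.
rewrite ler_pdivrMr ?exprn_gt0// mul1r (le_trans _ small)// ler_wpM2l ?mulr_ge0 ?(ltW C00)//.
by rewrite -[leRHS]expr1 ler_wiXn2l ?(ltW dl0).
Qed.

Let w := C0 * delta^-1 ^+ (2 * d).
Let w0 : 0 <= w. Proof. by rewrite mulr_ge0 ?(ltW C00)// exprn_ge0// invr_ge0 ltW. Qed.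

(** [Y < 1] puts each [E] below [g], so [E ^+ 4 <= E * g ^+ 3]: one factor reproduces the claimed
    sum, three pay for [w]. The covering factor [g^-1 >= 1] is given away at the end. *)
Lemma expo_absorb (E1 E2 E3 F1 F2 F3 : R) (N1 N2 n : nat) :
  delta <= c -> 0 <= E1 -> 0 <= E2 -> 0 <= E3 ->
  F1 <= E1 ^+ 4 -> F2 <= E2 ^+ 4 -> F3 <= E3 ^+ 4 ->
  (0 < N1)%N -> (0 < N2)%N -> (0 < n)%N ->
  let Y := (c / delta) ^+ d * ((N1 * N2 * n)%:R * E3 + N1%:R * E2 + E1) in
  Y < 1 -> w * (F1 + F2 + N2%:R * F3) <= Y.
Proof.
move=> dc E10 E20 E30 F1E F2E F3E N10 N20 n0 /=; rewrite covE => Y1.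
have n1 : 1 <= N1%:R :> R by rewrite ler1n.
have n2 : 1 <= N2%:R :> R by rewrite ler1n.
have n3 : N2%:R <= (N1 * N2 * n)%:R :> R.
  by rewrite ler_nat mulnAC leq_pmull// muln_gt0 N10.
set n123 := (_ * _ * _)%:R in Y1 n3 *.
set T := _ + E1 in Y1 *.
have a3 : E3 <= n123 * E3 by rewrite ler_peMl// (le_trans n2).
have a2 : E2 <= N1%:R * E2 by rewrite ler_peMl.
have b3 : N2%:R * E3 <= n123 * E3 by rewrite ler_wpM2r.
have Tg : T < g by move: Y1; rewrite mulrC ltr_pdivrMr// mul1r.
have T0 : 0 <= T by rewrite /T; lra.
have step E F : 0 <= E -> F <= E ^+ 4 -> E <= T -> F <= E * g ^+ 3.
  move=> E0 FE ET; rewrite (le_trans FE)// exprS ler_wpM2l// lerXn2r ?nnegrE ?(ltW g0)//.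
  by rewrite (le_trans ET)// ltW.
have f1 : F1 <= E1 * g ^+ 3 by apply: step => //; rewrite /T; lra.
have f2 : F2 <= E2 * g ^+ 3 by apply: step => //; rewrite /T; lra.
have f3 : F3 <= E3 * g ^+ 3 by apply: step => //; rewrite /T; lra.
have g1 : g <= 1 by rewrite exprn_ile1 ?divr_ge0 ?(ltW dl0) ?(ltW c0)// ler_pdivrMr// mul1r.
apply: (@le_trans _ _ (w * (T * g ^+ 3))).
  apply: ler_wpM2l => //.
  have : N2%:R * F3 <= N2%:R * (E3 * g ^+ 3) by rewrite ler_wpM2l.
  have : 0 <= g ^+ 3 by rewrite exprn_ge0// ltW.
  move=> h0 h; have h1 : N2%:R * E3 * g ^+ 3 <= n123 * E3 * g ^+ 3 by rewrite ler_wpM2r.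
  have h2 : E2 * g ^+ 3 <= N1%:R * E2 * g ^+ 3 by rewrite ler_wpM2r.
  by rewrite /T !mulrDl; lra.
have wg : w * g ^+ 3 <= 1.
  have := net_absorb; rewrite -/w; have : 0 <= w * g ^+ 3.
    by rewrite mulr_ge0// exprn_ge0// ltW.
  lra.
apply: (@le_trans _ _ T).
  by rewrite mulrCA -[leRHS]mulr1 ler_wpM2l.
by rewrite ler_peMl// -[leLHS]invr1 lef_pV2 ?posrE.
Qed.

(** The exponential is [(g * alpha) ^+ 3], at most [g ^+ 3 * alpha]; [net_absorb] then handles the
    sum of the three terms. *)
Lemma level_absorb (alpha F1 F2 F3 : R) (N2 : nat) : 0 < alpha < 1 ->
  let lg := d%:R * ln (c / delta) + ln alpha^-1 in
  F1 <= expR (- (3 * lg)) -> F2 <= expR (- (3 * lg)) ->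
  N2%:R * F3 <= expR (- (3 * lg)) ->
  w * (F1 + F2 + N2%:R * F3) <= alpha.
Proof.
move=> /andP[al0 al1] /= f1 f2 f3; set e := expR _ in f1 f2 f3.
have eE : e = (g * alpha) ^+ 3.
  have pw : 0 < c / delta by rewrite divr_gt0.
  rewrite /e -mulrN [3 * _]mulrC expRM_natr; congr (_ ^+ 3).
  rewrite opprD expRD !expRN lnK ?posrE ?invr_gt0// invrK; congr (_ * _).
  by rewrite mulrC expRM_natr lnK ?posrE// covE invrK.
have eg : e <= g ^+ 3 * alpha.
  rewrite eE exprMn; apply: ler_wpM2l; first by rewrite exprn_ge0// ltW.
  have : alpha ^+ 3 <= alpha ^+ 1 by rewrite ler_wiXn2l ?(ltW al0) ?(ltW al1).
  by rewrite expr1.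
apply: (@le_trans _ _ (w * (3 * (g ^+ 3 * alpha)))).
  by apply: ler_wpM2l => //; lra.
have -> : w * (3 * (g ^+ 3 * alpha)) = (w * g ^+ 3 * 3) * alpha by ring.
by rewrite -[leRHS]mul1r ler_wpM2r ?(ltW al0)//; exact: net_absorb.
Qed.

End absorption.

Lemma sup_ge0_mem {R : realType} (A : set R) : (forall x, A x -> 0 <= x) -> 0 <= sup A.
Proof.
move=> A0; have [[[x Ax] ubA]|nsup] := pselect (has_sup A); last by rewrite sup_out.
by rewrite (le_trans (A0 x Ax))// ub_le_sup.
Qed.

Section sigma_ge0.
Context {R : realType} {dx dy dth : nat} {S : finType}
  (z : S -> 'rV[R]_dx * 'rV[R]_dy) (pw : S -> R) {Z : Type}
  (Psi : Z -> 'rV[R]_dy -> R) (f : 'rV[R]_dth -> 'rV[R]_dx -> Z) (lam eps : R)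
  (Q : probability (@Borel R dx) R) (W : probability (@Borel R dy) R)
  (Th : set 'rV[R]_dth).

Let Var_ge0 d (mu : {measure set (@Borel R d) -> \bar R}) g : 0 <= Var mu g.
Proof. by apply: fine_ge0; apply: integral_ge0 => x _; rewrite lee_fin sqr_ge0. Qed.

Lemma sigma1sq_ge0 : (forall s, 0 < pw s) -> 0 <= sigma1sq z pw Psi f lam eps Q W Th.
Proof.
move=> pw0; apply: sup_ge0_mem => _ [th _ <-]; apply: sumr_ge0 => s _.
by rewrite mulr_ge0 ?sqr_ge0// ltW.
Qed.

Lemma sigma2sq_ge0 : 0 <= sigma2sq z pw Psi f lam eps Q W Th.
Proof. by apply: sup_ge0_mem => _ [th _ [s _ <-]]; exact: Var_ge0. Qed.

Lemma sigma3sq_ge0 : 0 <= sigma3sq z Psi f lam eps W Th.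
Proof.
apply: sup_ge0_mem => _ [th _ [s _ <-]]; apply: sumr_ge0 => s' _; exact: Var_ge0.
Qed.

End sigma_ge0.

(** A positive dimension guarantees the spare power of [delta] spent in [net_absorb]. *)
Lemma diam_gt0_dim {R : realType} {d : nat} (Th : set 'rV[R]_d) : 0 < diam Th -> (0 < d)%N.
Proof.
rewrite lt0n; apply: contraTneq => d0; move: Th; rewrite d0 => Th.
rewrite -leNgt /diam; have [[x0 Ax0]|nA] := pselect ([set enorm (a - b) | a in Th & b in Th]
  !=set0).
  apply: ge_sup; first by exists x0.
  by move=> _ [a _ [b _ <-]]; rewrite /enorm big_ord0 sqrtr0.
by rewrite sup_out// => -[].
Qed.

Lemma nmax_gt0 {R : realType} {dx dy : nat} {S : finType}
  (z : S -> 'rV[R]_dx * 'rV[R]_dy) (s : S) : (0 < nmax z)%N.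
Proof.
rewrite (leq_trans _ (leq_bigmax s))//; apply/card_gt0P; exists s.
by rewrite inE/= eqxx.
Qed.

Theorem theorem3 (R : realType) :
  exists C : R, 0 < C /\
  forall (dx dy dth : nat) (S : finType)
    (z : S -> 'rV[R]_dx * 'rV[R]_dy) (pw : S -> R)
    (p lam eps : R)
    (nuX : {measure set (Borel dx) -> \bar R}) (nuY : {measure set (Borel dy) -> \bar R})
    (Q : probability (Borel dx) R) (W : probability (Borel dy) R)
    (Z : Type) (Psi : Z -> 'rV[R]_dy -> R) (f : 'rV[R]_dth -> 'rV[R]_dx -> Z)
    (Th : set 'rV[R]_dth) (Lth B : R),
  (* the empirical distribution hat P *)
  injective z -> (forall s, 0 < pw s) -> \sum_(s : S) pw s = 1 ->
  (* parameters and kernel distributions *)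
  1 <= p -> 0 < lam -> 0 < eps ->
  kernel_law nuX p eps Q -> kernel_law nuY p eps W ->
  Psi_measurable Psi f ->
  (* Assumption 2 *)
  Th !=set0 -> has_ubound [set enorm (a - b) | a in Th & b in Th] -> 0 < diam Th ->
  (forall (x : 'rV[R]_dx) (y : 'rV[R]_dy) th th', Th th -> Th th' ->
     `|Psi (f th x) y - Psi (f th' x) y| <= Lth * enorm (th - th')) ->
  (forall zz y, 0 <= Psi zz y <= B) ->
  let L1 : R := 1 in
  let L2 : R := expR (B / (lam * eps)) in
  let L3 : R := (lam * eps)^-1 * expR (B / (lam * eps)) in
  let DTh := diam Th in
  let n := nmax z in
  let F := Fobj z pw Psi f lam eps Q W in
  let s1 := sigma1sq z pw Psi f lam eps Q W Th in
  let s2 := sigma2sq z pw Psi f lam eps Q W Th in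
  let s3 := sigma3sq z Psi f lam eps W Th in
  let cov (delta : R) := (8 * L1 * L2 * L3 * DTh / delta) ^+ dth in
  (* (a) *)
  (forall kappa : R, 0 < kappa -> exists delta1 : R, 0 < delta1 /\
    forall delta : R, 0 < delta < delta1 ->
    forall (N1 N2 N3 : nat), (0 < N1)%N -> (0 < N2)%N -> (0 < N3)%N ->
    forall (d0 : measure_display) (Om : measurableType d0) (P : probability Om R)
      (sx : 'I_N1 -> Om -> S) (x1 : 'I_N2 -> Om -> 'rV[R]_dx)
      (x2 : 'I_N3 -> Om -> 'rV[R]_dy) (thhat : Om -> 'rV[R]_dth) (thstar : 'rV[R]_dth),
    iid_samples pw Q W P sx x1 x2 ->
    Th thstar -> (forall th, Th th -> F thstar <= F th) ->
    (forall om, Th (thhat om) /\ forall th, Th th ->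
       Fhat z pw Psi f lam eps (fun i => sx i om) (fun j => x1 j om) (fun k => x2 k om) (thhat om)
       <= Fhat z pw Psi f lam eps (fun i => sx i om) (fun j => x1 j om) (fun k => x2 k om) th) ->
    exists A : set Om, measurable A /\
      [set om | F (thhat om) - F thstar > delta] `<=` A /\
      (P A <= (C * cov delta *
        ((N1 * N2 * n)%:R *
           expR (- (N3%:R * delta ^+ 2) /
             (144 * (2 + kappa) * lam ^+ 2 * eps ^+ 2 * L1 ^+ 2 * L2 ^+ 2 * s3))
         + N1%:R * expR (- (N2%:R * delta ^+ 2) /
             (144 * (2 + kappa) * lam ^+ 2 * eps ^+ 2 * L1 ^+ 2 * s2))
         + expR (- (N1%:R * delta ^+ 2) /
             (144 * (2 + kappa) * lam ^+ 2 * eps ^+ 2 * s1))))%:E)%E) /\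
  (* (b) *)
  (exists delta1 : R, 0 < delta1 /\
    forall delta : R, 0 < delta < delta1 -> forall alpha : R, 0 < alpha < 1 ->
    forall (N1 N2 N3 : nat), (0 < N1)%N -> (0 < N2)%N -> (0 < N3)%N ->
    let lg := dth%:R * ln (8 * L1 * L2 * L3 * DTh / delta) + ln alpha^-1 in
    N1%:R > C * s1 / delta ^+ 2 * lg ->
    N2%:R > C * L1 ^+ 2 * s2 / delta ^+ 2 * (lg + ln N1%:R) ->
    N3%:R > C * L1 ^+ 2 * L2 ^+ 2 * s3 / delta ^+ 2 * (lg + ln (N1 * N2 * n)%:R) ->
    forall (d0 : measure_display) (Om : measurableType d0) (P : probability Om R)
      (sx : 'I_N1 -> Om -> S) (x1 : 'I_N2 -> Om -> 'rV[R]_dx)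
      (x2 : 'I_N3 -> Om -> 'rV[R]_dy) (thhat : Om -> 'rV[R]_dth) (thstar : 'rV[R]_dth),
    iid_samples pw Q W P sx x1 x2 ->
    Th thstar -> (forall th, Th th -> F thstar <= F th) ->
    (forall om, Th (thhat om) /\ forall th, Th th ->
       Fhat z pw Psi f lam eps (fun i => sx i om) (fun j => x1 j om) (fun k => x2 k om) (thhat om)
       <= Fhat z pw Psi f lam eps (fun i => sx i om) (fun j => x1 j om) (fun k => x2 k om) th) ->
    exists A : set Om, measurable A /\
      A `<=` [set om | F (thhat om) - F thstar <= delta] /\
      ((1 - alpha)%:E <= P A)%E).
Proof.
(* The absolute constant can be 1 in both parts, since the rate [K] is at disposal. *)
exists 1; split => // dx dy dth S z pw p lam eps nuX nuY Q W Z Psi f Th Lth B.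
move=> _ pw0 pw1 _ lam0 eps0 _ _ mPsi Th0 Thub diam0 Plip Pbd L1 L2 L3 DTh n F s1 s2 s3 cov.
have dth0 := diam_gt0_dim diam0.
have ThD a b : Th a -> Th b -> enorm (a - b) <= DTh.
  by move=> Ta Tb; apply: ub_le_sup => //; exists a => //; exists b.
have n0 : (0 < n)%N.
  have [s _|S0] := pickP {: S}; first exact: nmax_gt0 s.
  by move: pw1; rewrite big_pred0// => /eqP; rewrite eq_sym oner_eq0.
pose c := 8 * L1 * L2 * L3 * DTh.
have L20 : 0 < L2 by exact: expR_gt0.
have c0 : 0 < c.
  rewrite /c /L1 mulr1; apply: mulr_gt0 => //; apply: mulr_gt0; first exact: mulr_gt0.
  by apply: mulr_gt0; [rewrite invr_gt0 mulr_gt0|exact: expR_gt0].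
have s10 : 0 <= s1 by exact: sigma1sq_ge0.
have s20 : 0 <= s2 by exact: sigma2sq_ge0.
have s30 : 0 <= s3 by exact: sigma3sq_ge0.
have tail K : 0 < K -> exists C0 delta1 : R, [/\ 0 < C0, 0 < delta1 &
    forall delta : R, 0 < delta < delta1 ->
    forall (N1 N2 N3 : nat), (0 < N1)%N -> (0 < N2)%N -> (0 < N3)%N ->
    forall (d0 : measure_display) (Om : measurableType d0) (P : probability Om R)
      (sx : 'I_N1 -> Om -> S) (x1 : 'I_N2 -> Om -> 'rV[R]_dx)
      (x2 : 'I_N3 -> Om -> 'rV[R]_dy) (thhat : Om -> 'rV[R]_dth) (thstar : 'rV[R]_dth),
    iid_samples pw Q W P sx x1 x2 ->
    Th thstar -> (forall th, Th th -> F thstar <= F th) ->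
    (forall om, Th (thhat om) /\ forall th, Th th ->
      Fhat z pw Psi f lam eps (sx ^~ om) (x1 ^~ om) (x2 ^~ om) (thhat om) <=
      Fhat z pw Psi f lam eps (sx ^~ om) (x1 ^~ om) (x2 ^~ om) th) ->
    exists A : set Om, [/\ measurable A,
      [set om | F (thhat om) - F thstar > delta] `<=` A &
      (P A <= (C0 * delta^-1 ^+ (2 * dth) *
        ((s1 != 0)%:R * expR (- (N1%:R * (K * delta ^+ 2))) +
         (s2 != 0)%:R * expR (- (N2%:R * (K * delta ^+ 2))) +
         N2%:R * ((s3 != 0)%:R * expR (- (N3%:R * (K * delta ^+ 2))))))%:E)%E]].
  move=> K0.
  (* [delta1] is chosen before [thstar], whereas the gap in [gap_tail] depends on a reference point.
     One minimizer is fixed here; all minimizers share its value, and if none exists the claim is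
     vacuous. *)
  have [[t0 Tt0 mt0]|nomin] := pselect (exists2 t0, Th t0 & forall th, Th th -> F t0 <= F th).
    have [C0 [delta1 [C00 delta10 H]]] := gap_tail z Q W pw0 pw1 lam0 eps0 mPsi Plip Pbd (ltW
      diam0) ThD Tt0 K0.
    exists C0, delta1; split => // delta dl N1 N2 N3 N10 N20 N30 d0 Om P sx x1 x2 thhat thstar
      iid Tst mst opt.
    have FE : F thstar = F t0.
      by apply/le_anti/andP; split; [exact: mst|exact: mt0].
    have [A [mA subA PA]] := H delta dl N1 N2 N3 N10 N20 N30 d0 Om P sx x1 x2 thhat iid opt.
    exists A; split; [exact: mA| |exact: PA].
    exact: (eq_ind_r (fun v => [set om | delta < F (thhat om) - v] `<=` A) subA FE).
  exists 1, 1; split => // delta _ N1 N2 N3 _ _ _ d0 Om P sx x1 x2 thhat thstar _ Tst mst.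
  by exfalso; apply: nomin; exists thstar.
have restrict (C0 delta1 : R) : 0 < C0 -> 0 < delta1 -> exists2 delta2 : R, 0 < delta2 &
    forall delta, 0 < delta < delta2 -> [/\ 0 < delta < delta1, delta <= 1, delta <= c &
      3 * C0 * delta <= c ^+ (3 * dth)].
  move=> C00 delta10; exists (Num.min delta1 (Num.min 1 (Num.min c (c ^+ (3 * dth) / (3 * C0))))).
    have q0 : 0 < c ^+ (3 * dth) / (3 * C0) by rewrite divr_gt0 ?exprn_gt0// mulr_gt0.
    by rewrite !lt_min delta10 ltr01 c0 q0.
  move=> delta /andP[dl0]; rewrite !lt_min => /and4P[-> /ltW-> /ltW-> h]; rewrite dl0; split => //.
  by move: h; rewrite ltr_pdivlMr ?mulr_gt0// mulrC => /ltW.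
split.
- move=> kappa kappa0.
  pose q1 := 144 * (2 + kappa) * lam ^+ 2 * eps ^+ 2 * s1.
  pose q2 := 144 * (2 + kappa) * lam ^+ 2 * eps ^+ 2 * L1 ^+ 2 * s2.
  pose q3 := 144 * (2 + kappa) * lam ^+ 2 * eps ^+ 2 * L1 ^+ 2 * L2 ^+ 2 * s3.
  have q_ge0 : [/\ 0 <= q1^-1, 0 <= q2^-1 & 0 <= q3^-1].
    have k2 : 0 <= 2 + kappa by rewrite addr_ge0// ltW.
    have u0 : 0 <= 144 * (2 + kappa) * lam ^+ 2 * eps ^+ 2 by rewrite !mulr_ge0//; exact: ltW.
    have u1 : 0 <= 144 * (2 + kappa) * lam ^+ 2 * eps ^+ 2 * L1 ^+ 2.
      by apply: mulr_ge0 => //; exact: sqr_ge0.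
    have u2 : 0 <= 144 * (2 + kappa) * lam ^+ 2 * eps ^+ 2 * L1 ^+ 2 * L2 ^+ 2.
      by apply: mulr_ge0 => //; exact: sqr_ge0.
    by split; rewrite invr_ge0; exact: mulr_ge0.
  have [q10 q20 q30] := q_ge0.
  (* The 4 supplies the fourth powers of [expo_absorb]. A zero sigma has inverse 0 by convention,
     and the summand 1 keeps [K] positive. *)
  pose K := 4 * (q1^-1 + q2^-1 + q3^-1) + 1.
  have K0 : 0 < K by rewrite /K; lra.
  have [C0 [delta1 [C00 delta10 H]]] := tail K K0.
  have [delta2 delta20 dsmall] := restrict C0 delta1 C00 delta10.
  exists delta2; split => // delta /dsmall[dd1 dl1 dc dabs].
  move=> N1 N2 N3 N10 N20 N30 d0 Om P sx x1 x2 thhat thstar iid Tst mst opt.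
  rewrite mul1r; set Y := cov delta * _.
  have [Y1|Y1] := leP 1 Y.
    exists setT; split => //; split => //.
    by rewrite probability_setT lee_fin.
  have [A [mA subA PA]] := H delta dd1 N1 N2 N3 N10 N20 N30 d0 Om P sx x1 x2 thhat thstar iid
    Tst mst opt.
  exists A; split => //; split => //; apply: (le_trans PA); rewrite lee_fin.
  have /andP[dl0 _] := dd1.
  have rate (s q : R) (N : nat) : 4 * q^-1 <= K ->
      (s != 0)%:R * expR (- (N%:R * (K * delta ^+ 2))) <= expR (- (N%:R * delta ^+ 2) / q) ^+ 4.
    move=> qK; have [_|_] := eqVneq s 0; first by rewrite mul0r exprn_ge0// expR_ge0.
    rewrite mul1r -expRM_natr ler_expR.
    rewrite (_ : _ / q * 4 = - (N%:R * (4 * q^-1 * delta ^+ 2))); last by ring.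
    by rewrite lerN2 ler_wpM2l// ler_wpM2r// sqr_ge0.
  apply: (expo_absorb C00 c0 dl0 dl1 dth0 dabs dc) => //; try exact: expR_ge0.
  + by apply: rate; rewrite -/q1 /K; lra.
  + by apply: rate; rewrite -/q2 /K; lra.
  + by apply: rate; rewrite -/q3 /K; lra.
(* The 3 turns the sample-size conditions into the exponents required by [level_absorb]. *)
- pose K := 3 * (s1^-1 + s2^-1 + s3^-1) + 1.
  have i1 : 0 <= s1^-1 by rewrite invr_ge0.
  have i2 : 0 <= s2^-1 by rewrite invr_ge0.
  have i3 : 0 <= s3^-1 by rewrite invr_ge0.
  have K0 : 0 < K by rewrite /K; lra.
  have [C0 [delta1 [C00 delta10 H]]] := tail K K0.
  have [delta2 delta20 dsmall] := restrict C0 delta1 C00 delta10.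
  exists delta2; split => // delta /dsmall[dd1 dl1 dc dabs] alpha al01.
  move=> N1 N2 N3 N10 N20 N30 lg hN1 hN2 hN3 d0 Om P sx x1 x2 thhat thstar iid Tst mst opt.
  have [A [mA subA PA]] := H delta dd1 N1 N2 N3 N10 N20 N30 d0 Om P sx x1 x2 thhat thstar iid
    Tst mst opt.
  have /andP[dl0 _] := dd1; have /andP[al0 al1] := al01.
  exists (~` A); split; first exact: measurableC.
  split; first by move=> om nA /=; rewrite leNgt; apply/negP => gap; apply: nA; exact: subA.
  suff PAal : (P A <= alpha%:E)%E by rewrite probability_setC// EFinB leeB.
  apply: (le_trans PA); rewrite lee_fin.
  have lg0 : 0 <= lg.
    rewrite addr_ge0//; last by rewrite ln_ge0// invf_ge1// ltW.
    by rewrite mulr_ge0// ln_ge0// ler_pdivlMr// mul1r.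
  have rate (s x : R) (N : nat) : 0 <= s -> 3 * s^-1 <= K -> s / delta ^+ 2 * x < N%:R ->
      (s != 0)%:R * expR (- (N%:R * (K * delta ^+ 2))) <= expR (- (3 * x)).
    move=> s0 sK; have [_|sn0] := eqVneq s 0; first by rewrite mul0r expR_ge0.
    have sp : 0 < s by rewrite lt_def sn0.
    rewrite mulrAC ltr_pdivrMr ?exprn_gt0// => /ltW sN; rewrite mul1r ler_expR lerN2.
    rewrite (_ : 3 * x = 3 * s^-1 * (s * x)); last by field.
    rewrite [N%:R * (K * _)]mulrCA; apply: (@le_trans _ _ (3 * s^-1 * (N%:R * delta ^+ 2))).
      by apply: ler_wpM2l => //; apply: mulr_ge0 => //; rewrite invr_ge0.
    by apply: ler_wpM2r => //; apply: mulr_ge0 => //; exact: sqr_ge0.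
  have lnN (N : nat) : (0 < N)%N -> 0 <= ln (N%:R : R) by move=> N0; rewrite ln_ge0// ler1n.
  have K1 : 3 * s1^-1 <= K by rewrite /K; lra.
  have K2 : 3 * s2^-1 <= K by rewrite /K; lra.
  have K3 : 3 * s3^-1 <= K by rewrite /K; lra.
  apply: (level_absorb C00 c0 dl0 dl1 dth0 dabs al01).
  + by apply: rate => //; move: hN1; rewrite mul1r.
  + apply: (le_trans (rate s2 (lg + ln N1%:R) N2 s20 K2 _)).
      by move: hN2; rewrite /L1 expr1n !mul1r.
    by rewrite ler_expR lerN2 ler_wpM2l// lerDl lnN.
  + set X := lg + ln _ in hN3.
    have XN2 : lg + ln N2%:R <= X.
      rewrite lerD2l ler_ln ?posrE ?ltr0n// ?muln_gt0 ?N10 ?N20 ?n0//.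
      by rewrite ler_nat mulnAC leq_pmull// muln_gt0 N10.
    have lnN2 := lnN N2 N20.
    have X0 : 0 <= X by apply: le_trans XN2; exact: addr_ge0.
    have XL : X <= L2 ^+ 2 * X.
      rewrite ler_peMl// exprn_ege1// -expR0 ler_expR.
      exact: (beta_ge0 f lam0 eps0 Pbd).
    have F3 := rate s3 (L2 ^+ 2 * X) N3 s30 K3.
    apply: (@le_trans _ _ (N2%:R * expR (- (3 * (L2 ^+ 2 * X))))).
      rewrite ler_wpM2l//; apply: F3; move: hN3.
      rewrite /L1 expr1n !mul1r; congr (_ < _); ring.
    (* The factor [N2] from the union over [x1 j] is paid by the term [ln (N1 * N2 * n)%:R] in the
       condition on [N3]. *)
    rewrite -[X in X * _](@lnK _ N2%:R) ?posrE ?ltr0n// -expRD ler_expR.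
    have fin (u v x y : R) : u + v <= x -> x <= y -> 0 <= v -> v + - (3 * y) <= - (3 * u).
      by move=> *; lra.
    exact: fin XN2 XL lnN2.
Qed.
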